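(* Let $\mathbf X_1,\dots,\mathbf X_n$ be iid in $\mathbb R^p$ with distribution $F$ and $\mathbf X_1',\dots,\mathbf X_n'$ an independent copy. Let $f:\mathbb R^p\times\mathbb R^p\to\mathbb R^{p\times p}$ be a symmetric kernel which is canonical with respect to $F$, with $\mathbb E\|f(\mathbf X_1,\mathbf X_2)\|<\infty$, and let $V=\binom n2^{-1}\sum_{1\le i<j\le n}f(\mathbf X_i,\mathbf X_j)$. Let $M=\max_{1\le i<j\le n}(\|f(\mathbf X_i,\mathbf X_j)\|\vee\|f(\mathbf X_i,\mathbf X_j')\|)$ and $D_q=\max_{1\le m,k\le p}(\mathbb E|f_{mk}(\mathbf X_1,\mathbf X_2)|^q)^{1/q}$ for $q>0$. If $2\le p\le\exp(bn)$ for some absolute constant $b>0$, then there exists an absolute constant $K>0$ such that $$\mathbb E\|V\|\le K(1\vee b^{1/2})\Big\{\Big(\frac{\log p}{n}\Big)^{3/2}\|M\|_4+\frac{\log p}{n}D_2+\Big(\frac{\log p}{n}\Big)^{5/4}D_4\Big\}.$$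
   Context: $\|A\|=\max_{m,k}|A_{mk}|$ for a matrix $A$; $\|Y\|_q=(\mathbb E|Y|^q)^{1/q}$. The kernel $f$ is canonical (completely degenerate) w.r.t. $F$ if $\mathbb E f_{mk}(\mathbf x_1,\mathbf X')=\mathbb E f_{mk}(\mathbf X,\mathbf x_2)=\mathbb Ef_{mk}(\mathbf X,\mathbf X')=0$ for all $m,k$ and all $\mathbf x_1,\mathbf x_2\in\mathbb R^p$, where $\mathbf X,\mathbf X'$ are independent with distribution $F$. Symmetric means $f(\mathbf x_1,\mathbf x_2)=f(\mathbf x_2,\mathbf x_1)$. *)

(* Defs.v *)
From HB Require Import structures.
From mathcomp Require Import all_boot all_order all_algebra.
From mathcomp Require Import all_classical all_reals all_analysis.
Set Implicit Arguments.
Unset Strict Implicit.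
Unset Printing Implicit Defensive.
Import Order.TTheory GRing.Theory Num.Theory.
Local Open Scope classical_set_scope.
Local Open Scope ring_scope.

(* R^p is represented as [p.-tuple R], with its product (Borel) sigma-algebra
   provided by mathcomp-analysis (generated by the coordinate projections). *)

Definition pl_maxnorm {R : realType} {p : nat} (A : 'M[R]_p) : R :=
  \big[Num.max/0]_(m < p) \big[Num.max/0]_(k < p) `|A m k|.

Definition pl_mutually_independent {d} {T : measurableType d} {R : realType}
    (P : probability T R) {I : finType} {p : nat}
    (Y : I -> T -> p.-tuple R) : Prop :=
  forall A : I -> set (p.-tuple R), (forall i, measurable (A i)) ->
    P (\bigcap_(i in [set: I]) (Y i @^-1` A i)) =
    (\prod_(i : I) P (Y i @^-1` A i))%E.

Definition pl_has_distribution {d} {T : measurableType d} {R : realType}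
    (P : probability T R) {p : nat} (Y : T -> p.-tuple R)
    (F : probability (p.-tuple R) R) : Prop :=
  forall A : set (p.-tuple R), measurable A -> P (Y @^-1` A) = F A.

Definition pl_symmetric_kernel {R : realType} {p : nat}
    (f : p.-tuple R -> p.-tuple R -> 'M[R]_p) : Prop :=
  forall x1 x2, f x1 x2 = f x2 x1.

Definition pl_measurable_kernel {R : realType} {p : nat}
    (f : p.-tuple R -> p.-tuple R -> 'M[R]_p) : Prop :=
  forall m k : 'I_p,
    measurable_fun [set: p.-tuple R * p.-tuple R] (fun z => f z.1 z.2 m k).

Definition pl_canonical_kernel {R : realType} {p : nat}
    (F : probability (p.-tuple R) R)
    (f : p.-tuple R -> p.-tuple R -> 'M[R]_p) : Prop :=
  forall m k : 'I_p,
    (forall x1, (\int[F]_y (f x1 y m k)%:E = 0)%E) /\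
    (forall x2, (\int[F]_x (f x x2 m k)%:E = 0)%E) /\
    (\int[(F \x F)%E]_z (f z.1 z.2 m k)%:E = 0)%E.

Definition pl_Ustat {T : Type} {R : realType} {n p : nat}
    (f : p.-tuple R -> p.-tuple R -> 'M[R]_p)
    (X : 'I_n -> T -> p.-tuple R) (w : T) : 'M[R]_p :=
  ('C(n, 2))%:R^-1 *: \sum_(i < n) \sum_(j < n | (i < j)%N) f (X i w) (X j w).

Definition pl_Mmax {T : Type} {R : realType} {n p : nat}
    (f : p.-tuple R -> p.-tuple R -> 'M[R]_p)
    (X X' : 'I_n -> T -> p.-tuple R) (w : T) : R :=
  \big[Num.max/0]_(i < n) \big[Num.max/0]_(j < n | (i < j)%N)
     Num.max (pl_maxnorm (f (X i w) (X j w))) (pl_maxnorm (f (X i w) (X' j w))).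

Definition pl_Dq {R : realType} {p : nat} (F : probability (p.-tuple R) R)
    (f : p.-tuple R -> p.-tuple R -> 'M[R]_p) (q : R) : \bar R :=
  (\big[maxe/0]_(m < p) \big[maxe/0]_(k < p)
     Lnorm (F \x F)%E q%:E (fun z => (f z.1 z.2 m k)%:E))%E.

(* Main.v *)
Require Import Defs.
From HB Require Import structures.
From mathcomp Require Import all_boot all_order all_algebra.
From mathcomp Require Import all_classical all_reals all_analysis.
From mathcomp Require Import measurable_realfun ring lra.
Import Order.TTheory GRing.Theory Num.Theory.
Local Open Scope classical_set_scope.
Local Open Scope ring_scope.
Set Implicit Arguments.
Unset Strict Implicit.

(** If [e] is a vector of signs and [S] the set of its positive entries, then
    [1 = 2 (1_S 1_S + 1_S' 1_S') - e_a e_b] on pairs [(a, b)].  Since the kernel is canonical, the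
    parts of the U-statistic supported on [S] and on its complement [S'] are conditional
    expectations of the signed sum, so [E ||U|| <= 5 E ||sum e_a e_b f (X_a, X_b)||] for every [e],
    without decoupling.  Averaging over [e] leaves, conditionally on the sample, a Rademacher chaos
    of order two; its exponential moments are bounded by induction on the number of signs, and a
    maximal inequality costs one factor [log p].  This reduces the theorem to bounding the
    expectation of [max_{m,k} sum_{a<b} f_mk (X_a, X_b)^2].  The pairs with [a + b] fixed modulo [n]
    form a matching, along which the summands are independent; truncating them at twice the
    expected maximum [E M^2] and using exponential moments gives a bound of order
    [n log p E M^2 + n^2 D_2^2]. *)

(** * Rademacher chaos of order two *)

(** The exponent 3/2 in front of the maximum is 1 + 1/2. A chaos of order two has exponential, not
    Gaussian, tails, so the maximum over the [p ^ 2] entries costs a full logarithm. The remaining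
    half comes from the variance: its part [n log p E M^2], under a square root and divided by the
    order [n ^ 2] of the number of pairs, leaves one more factor [sqrt (log p / n)]. The Rademacher
    bound is stated as a multiple of [th + 64 * S / th], with [th] free, instead of the square root
    of the conditional variance [S]. Being linear in [S], it can be integrated over the sample, and
    a deterministic [th] is chosen afterwards. The squares of the kernel are dependent through
    shared indices, which rules out a direct exponential moment bound. A matching restores
    independence, and summing over [n] matchings keeps the variance part at its natural order
    [n ^ 2]. Conditional expectations appear as integrals over one resampled coordinate of the
    product law on tuples. *)

Lemma cosh_le_expR_sqr (R : realType) (x : R) :
  expR x + expR (- x) <= 2 * expR (2 * x ^+ 2).
Proof.
wlog x0 : x / 0 <= x.
  move=> H; have [/H//|/ltW x0] := leP 0 x.
  have := H (- x); rewrite opprK sqrrN oppr_ge0 => /(_ x0).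
  by rewrite [_ + expR x]addrC.
(* The exponent [2 * x ^+ 2], weaker than the sharp [x ^+ 2 / 2], allows an elementary proof: from
   1/2 on, [x <= 2 * x ^+ 2]; below 1/2, [expR y <= (1 - y)^-1] at [x] and [- x] gives the sum
   [2 / (1 - x ^+ 2)]. *)
have [xh|xh] := leP (1 / 2) x.
  have h1 : expR x <= expR (2 * x ^+ 2) by rewrite ler_expR; nra.
  have h2 : expR (- x) <= expR x by rewrite ler_expR; lra.
  lra.
have inv (y : R) : y < 1 -> expR y <= (1 - y)^-1.
  move=> y1; rewrite -(invrK (expR y)) -expRN lef_pV2 ?posrE ?expR_gt0//.
    by have := expR_ge1Dx (- y); lra.
  by lra.
have h1 := inv x ltac:(lra).
have h2 := inv (- x) ltac:(lra).
have h3 := expR_ge1Dx (2 * x ^+ 2).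
have h4 : (1 - x)^-1 + (1 - - x)^-1 = 2 / (1 - x ^+ 2).
  by field; rewrite ?gt_eqF//; nra.
apply: (@le_trans _ _ (2 / (1 - x ^+ 2))); first by rewrite -h4; lra.
rewrite ler_pdivrMr; last by nra.
have u1 : x ^+ 2 <= 1 / 4 by nra.
have u0 := sqr_ge0 x.
have u2 : 0 <= (expR (2 * x ^+ 2) - (1 + 2 * x ^+ 2)) * (1 - x ^+ 2).
  by rewrite mulr_ge0 ?subr_ge0//; lra.
nra.
Qed.

(** Rademacher averages are finite sums over this list, normalised by [2 ^ n]; the recursion exposes
    the first sign, on which the chaos bound is proved by induction. *)
Fixpoint signs (R : realType) (n : nat) : seq (seq R) :=
  if n is m.+1 then
    [seq 1 :: e | e <- signs R m] ++ [seq -1 :: e | e <- signs R m]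
  else [:: [::]].
Arguments signs : clear implicits.

Lemma size_signs (R : realType) n : size (signs R n) = (2 ^ n)%N.
Proof. by elim: n => //= n IH; rewrite size_cat !size_map IH addnn -mul2n expnS. Qed.

Lemma signsP (R : realType) n (e : seq R) (i : 'I_n) :
  e \in signs R n -> e`_i = 1 \/ e`_i = -1.
Proof.
elim: n e i => [|n IH] e; first by case.
move=> [[|i] Hi] /=; rewrite mem_cat => /orP[] /mapP[e' e'S ->] /=; [by left|by right|..];
by exact: (IH e' (Ordinal (Hi : (i < n)%N))).
Qed.

(** Cauchy-Schwarz for the Frobenius product of [B] with the rank one matrix of entries [b i * b j],
    whose norm is the sum of the [b i ^+ 2]; 1/16 is the square root of 1/256. *)
Lemma quadform_le (R : realType) n (B : 'I_n -> 'I_n -> R) (b : 'I_n -> R) :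
  \sum_i \sum_j B i j ^+ 2 <= 1 / 256 ->
  \sum_i \sum_j B i j * (b i * b j) <= (\sum_i b i ^+ 2) / 16.
Proof.
move=> yle; set t := \sum_i b i ^+ 2; set q := \sum_i _.
have t0 : 0 <= t by apply: sumr_ge0 => i _; exact: sqr_ge0.
have tt : \sum_i \sum_j (b i * b j) ^+ 2 = t ^+ 2.
  rewrite expr2 big_distrl /=; apply: eq_bigr => i _; rewrite big_distrr /=.
  by apply: eq_bigr => j _; rewrite exprMn.
(* With the multiplier [16 * t] both square terms are at most [t ^+ 2], so
   [32 * t * q <= 2 * t ^+ 2]. Dividing by [t] leaves the case [t = 0], where [b] vanishes. *)
have : 0 <= \sum_i \sum_j (16 * t * B i j - b i * b j) ^+ 2.
  by apply: sumr_ge0 => i _; apply: sumr_ge0 => j _; exact: sqr_ge0.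
have E (c : R) : \sum_i \sum_j (16 * c * B i j - b i * b j) ^+ 2 =
   256 * c ^+ 2 * (\sum_i \sum_j B i j ^+ 2) - 32 * c * q + \sum_i \sum_j (b i * b j) ^+ 2.
  rewrite /q !big_distrr -sumrB -big_split /=; apply: eq_bigr => i _.
  rewrite !big_distrr -sumrB -big_split /=; apply: eq_bigr => j _; ring.
rewrite E tt; move=> H; have [t_gt0|] := ltP 0 t.
  have : 32 * (t * q) <= 2 * t * t by nra.
  move=> H1; rewrite -(ler_pM2l t_gt0); lra.
move=> tle; have teq : t = 0 by lra.
have b0 i : b i = 0.
  apply/eqP; rewrite -sqrf_eq0; have /eqP := teq.
  rewrite /t psumr_eq0; last by move=> *; exact: sqr_ge0.
  by move=> /allP/(_ i); rewrite mem_index_enum; exact.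
rewrite /q big1 ?teq ?mul0r// => i _; rewrite big1// => j _; by rewrite b0 mul0r mulr0.
Qed.

(* Averaging over the first sign turns the quadratic form [A] into [B + 2 b b^T], where [B] is
   the remaining block and [b] the symmetrised off-diagonal part of the first row; the
   Frobenius norm decreases by at least a fixed fraction of the increase of the trace. *)
Lemma rademacher_chaos_expR (R : realType) n (A : 'I_n -> 'I_n -> R) :
  \sum_i \sum_j A i j ^+ 2 <= 1 / 256 ->
  \sum_(e <- signs R n) expR (\sum_i \sum_j A i j * (e`_i * e`_j)) <=
  2 ^+ n * expR (\sum_i A i i + 10 * \sum_i \sum_j A i j ^+ 2).
Proof.
elim: n A => [|n IH] A hA.
  by rewrite /= big_seq1 !big_ord0 mulr0 add0r expr0 mul1r.
pose B i j := A (lift ord0 i) (lift ord0 j).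
pose b i := A ord0 (lift ord0 i) + A (lift ord0 i) ord0.
pose A' i j := B i j + 2 * (b i * b j).
pose y := \sum_i \sum_j B i j ^+ 2.
pose t := \sum_i b i ^+ 2.
pose x := \sum_i \sum_j A i j ^+ 2.
have t0 : 0 <= t by apply: sumr_ge0 => i _; exact: sqr_ge0.
have y0 : 0 <= y.
  by apply: sumr_ge0 => i _; apply: sumr_ge0 => j _; exact: sqr_ge0.
have xE : x = A ord0 ord0 ^+ 2 +
    \sum_i (A ord0 (lift ord0 i) ^+ 2 + A (lift ord0 i) ord0 ^+ 2) + y.
  rewrite /x big_ord_recl big_ord_recl /= -addrA -[in RHS]addrA; congr (_ + _).
  rewrite big_split /= -addrA; congr (_ + _); rewrite -big_split /=.
  by apply: eq_bigr => i _; rewrite big_ord_recl.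
have xge : y + t / 2 <= x.
  rewrite xE; have : t / 2 <= \sum_i (A ord0 (lift ord0 i) ^+ 2 + A (lift ord0 i) ord0 ^+ 2).
    rewrite /t big_distrl /=; apply: ler_sum => i _; rewrite /b.
    have := sqr_ge0 (A ord0 (lift ord0 i) - A (lift ord0 i) ord0); lra.
  have := sqr_ge0 (A ord0 ord0); lra.
have yle : y <= 1 / 256 by rewrite -/x in hA; lra.
have cross := @quadform_le R n B b yle.
have tt : \sum_i \sum_j (b i * b j) ^+ 2 = t ^+ 2.
  rewrite expr2 big_distrl /=; apply: eq_bigr => i _; rewrite big_distrr /=.
  by apply: eq_bigr => j _; rewrite exprMn.
have x'E : \sum_i \sum_j A' i j ^+ 2 =
    y + 4 * (\sum_i \sum_j B i j * (b i * b j)) + 4 * t ^+ 2.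
  rewrite -tt !big_distrr -!big_split /=; apply: eq_bigr => i _.
  by rewrite !big_distrr -!big_split /=; apply: eq_bigr => j _; rewrite /A'; ring.
have tle : t <= 1 / 128 by rewrite -/x in hA; lra.
(* The cross term is at most [t / 4], and [4 * t ^+ 2 <= t / 32]. Compared with [xge], the squared
   norm has dropped by at least [7 * t / 32] while the trace gained [2 * t]; the factor 10 of the
   conclusion is there because [10 * 7 / 32 >= 2]. *)
have x'le : \sum_i \sum_j A' i j ^+ 2 <= y + t / 4 + t / 32.
  rewrite x'E; rewrite -/t in cross; nra.
have trE : \sum_i A' i i = \sum_i B i i + 2 * t.
  rewrite big_split /=; congr (_ + _); rewrite big_distrr /=.
  by apply: eq_bigr => i _; rewrite expr2.
have trA : \sum_i A i i = A ord0 ord0 + \sum_i B i i by rewrite big_ord_recl.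
have hA' : \sum_i \sum_j A' i j ^+ 2 <= 1 / 256 by rewrite -/x in hA; lra.
apply: (@le_trans _ _ (2 * expR (A ord0 ord0) *
   \sum_(e <- signs R n) expR (\sum_i \sum_j A' i j * (e`_i * e`_j)))); last first.
  apply: (@le_trans _ _ (2 * expR (A ord0 ord0) * (2 ^+ n *
     expR (\sum_i A' i i + 10 * \sum_i \sum_j A' i j ^+ 2)))).
    by rewrite ler_wpM2l ?IH// mulr_ge0 ?expR_ge0.
  rewrite exprS mulrACA -expRD -/x ler_wpM2l ?mulr_ge0 ?exprn_ge0//.
  by rewrite ler_expR trE trA; lra.
rewrite [signs _ _]/= big_cat /= !big_map -big_split /= big_distrr /= !big_seq.
apply: ler_sum => e eS.
(* The form is affine in the first sign, so the two values of that sign add up to a hyperbolic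
   cosine of the linear form [l]. Its bound [expR (2 * l ^+ 2)] is again the exponential of a
   quadratic form; the diagonal of that form is the reason why the statement carries a trace. *)
have QE (s : R) : s ^+ 2 = 1 -> \sum_i \sum_j A i j * ((s :: e)`_i * (s :: e)`_j) =
   A ord0 ord0 + \sum_i \sum_j B i j * (e`_i * e`_j) + s * \sum_i b i * e`_i.
  move=> s1; rewrite big_ord_recl big_ord_recl /= -expr2 s1 mulr1 -!addrA; congr (_ + _).
  rewrite [in RHS]addrC !big_distrr -!big_split /=; apply: eq_bigr => i _.
  rewrite big_ord_recl /= addrA /b; congr (_ + _); ring.
rewrite !QE ?expr1n ?sqrrN ?expr1n//.
set Q := \sum_i _; set l := \sum_i b i * _.
have -> : \sum_i \sum_j A' i j * (e`_i * e`_j) = Q + 2 * l ^+ 2.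
  rewrite expr2 [l * l]big_distrl !big_distrr -!big_split /=; apply: eq_bigr => i _.
  rewrite !big_distrr -!big_split /=; apply: eq_bigr => j _; rewrite /A'; ring.
rewrite mul1r mulN1r !expRD -mulrDr.
have H : 0 <= expR (A ord0 ord0) * expR Q * (2 * expR (2 * l ^+ 2) - (expR l + expR (- l))).
  by rewrite !mulr_ge0 ?expR_ge0// subr_ge0 cosh_le_expR_sqr.
by rewrite -subr_ge0; apply: le_trans H _; rewrite le_eqVlt; apply/orP; left; apply/eqP; ring.
Qed.

(** A pointwise maximal inequality: with [L] the logarithm of the size of a family, the exponentials
    of all its members, shifted by [L], add up to an average. *)
Lemma le_shift_expR (R : realType) (y L : R) : y <= L + expR (y - L).
Proof. by have := expR_ge1Dx (y - L); lra. Qed.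

(** The scale [mu = th + 64 * S / th] satisfies [mu ^+ 2 >= 256 * S] for every [th], by the
    arithmetic-geometric mean inequality, so the forms divided by [mu] meet the smallness condition
    of the exponential bound. Without diagonal, their exponential moments are at most
    [expR (10 / 256)]; the factor 2 accounts for the absolute value. *)
Lemma rademacher_chaos_max (R : realType) (J : finType) n
    (a : J -> 'I_n -> 'I_n -> R) (S th : R) :
  (0 < #|J|)%N -> 0 < th -> (forall j i, a j i i = 0) ->
  (forall j, \sum_i \sum_k a j i k ^+ 2 <= S) ->
  \sum_(e <- signs R n) \big[Num.max/0]_j `|\sum_i \sum_k a j i k * (e`_i * e`_k)| <=
  2 ^+ n * ((ln #|J|%:R + 2 * expR (10 / 256)) * (th + 64 * S / th)).
Proof.
move=> J0 th0 a0 aS.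
have S0 : 0 <= S.
  have /card_gt0P[j _] := J0; apply: le_trans (aS j).
  by apply: sumr_ge0 => i _; apply: sumr_ge0 => k _; exact: sqr_ge0.
set L := ln _; set C := 2 * _; set mu := th + _.
have J0' : 0 < #|J|%:R :> R by rewrite ltr0n.
have eL : expR (- L) * #|J|%:R = 1.
  by rewrite expRN lnK ?posrE// mulVf ?gt_eqF.
have L0 : 0 <= L by rewrite ln_ge0// ler1n.
have Sth : 0 <= S / th by rewrite divr_ge0// ltW.
have mu0 : 0 < mu by rewrite /mu -mulrA; lra.
have muS : mu^-1 ^+ 2 * S <= 1 / 256.
  rewrite exprVn mulrC ler_pdivrMr ?exprn_gt0//.
  have SE : S = th * (S / th) by rewrite mulrC divfK// gt_eqF.
  rewrite {1}SE /mu -mulrA; have := sqr_ge0 (th - 64 * (S / th)); lra.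
pose c (e : seq R) j := \sum_i \sum_k a j i k * (e`_i * e`_k).
have scale (s : R) (e : seq R) j :
    \sum_i \sum_k (s * a j i k) * (e`_i * e`_k) = s * c e j.
  rewrite /c big_distrr /=; apply: eq_bigr => i _; rewrite big_distrr /=.
  by apply: eq_bigr => k _; rewrite -mulrA.
have bnd (s : R) j : s ^+ 2 * S <= 1 / 256 ->
    \sum_(e <- signs R n) expR (s * c e j) <= 2 ^+ n * expR (10 / 256).
  move=> sS; under eq_bigr do rewrite -scale.
  have sE : \sum_i \sum_k (s * a j i k) ^+ 2 = s ^+ 2 * \sum_i \sum_k a j i k ^+ 2.
    rewrite big_distrr /=; apply: eq_bigr => i _; rewrite big_distrr /=.
    by apply: eq_bigr => k _; rewrite exprMn.
  have sle : \sum_i \sum_k (s * a j i k) ^+ 2 <= 1 / 256.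
    by rewrite sE; apply: le_trans sS; rewrite ler_wpM2l ?sqr_ge0.
  apply: le_trans (rademacher_chaos_expR sle) _.
  rewrite ler_wpM2l ?exprn_ge0// ler_expR big1; first by lra.
  by move=> i _; rewrite a0 mulr0.
apply: (@le_trans _ _ (\sum_(e <- signs R n) mu * (L + expR (- L) *
    \sum_j (expR (mu^-1 * c e j) + expR (- mu^-1 * c e j))))).
  apply: ler_sum => e _; apply: bigmax_le => [|j _].
    rewrite mulr_ge0 ?(ltW mu0)// addr_ge0// mulr_ge0 ?expR_ge0//.
    by apply: sumr_ge0 => j _; rewrite addr_ge0 ?expR_ge0.
  rewrite -/(c e j) -ler_pdivrMl//.
  have -> : mu^-1 * `|c e j| = `|mu^-1 * c e j|.
    by rewrite normrM [`|mu^-1|]gtr0_norm ?invr_gt0.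
  have h1 : expR (mu^-1 * c e j) + expR (- mu^-1 * c e j) <=
      \sum_j (expR (mu^-1 * c e j) + expR (- mu^-1 * c e j)).
    rewrite [leRHS](bigD1 j)//= lerDl; apply: sumr_ge0 => i _.
    by rewrite addr_ge0 ?expR_ge0.
  have := ler_wpM2l (expR_ge0 (- L)) h1; rewrite mulrDr -!expRD ![- L + _]addrC.
  have h2 := le_shift_expR (mu^-1 * c e j) L.
  have h3 := le_shift_expR (- mu^-1 * c e j) L.
  have e1 := expR_ge0 (mu^-1 * c e j - L).
  have e2 := expR_ge0 (- mu^-1 * c e j - L).
  move=> h4; rewrite mulNr in h2 h3 h4 e1 e2 *; rewrite ler_norml; apply/andP; split; lra.
rewrite -big_distrr/= big_split/= -big_distrr/= exchange_big/=.
have -> : \sum_(e <- signs R n) L = 2 ^+ n * L.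
  by rewrite big_const_seq count_predT size_signs iter_addr_0 -natrX mulr_natl.
have h : \sum_j \sum_(e <- signs R n) (expR (mu^-1 * c e j) + expR (- mu^-1 * c e j)) <=
    #|J|%:R * (2 ^+ n * C).
  apply: (@le_trans _ _ (\sum_(j : J) (2 ^+ n * C))); last first.
    by rewrite sumr_const mulr_natl.
  apply: ler_sum => j _; rewrite big_split/=.
  have h1 := bnd mu^-1 j muS.
  have h2 : \sum_(e <- signs R n) expR (- mu^-1 * c e j) <= 2 ^+ n * expR (10 / 256).
    by apply: bnd; rewrite sqrrN.
  by rewrite /C; lra.
have h' := ler_wpM2l (expR_ge0 (- L)) h; rewrite (mulrA (expR (- L))) eL mul1r in h'.
rewrite [_ * mu]mulrC mulrCA ler_wpM2l ?(ltW mu0)// mulrDr; lra.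
Qed.

(** * Product laws on tuples *)

Section tuple_law.
Context d (E : measurableType d) (R : realType) (n : nat).

Definition tuple_box (B : 'I_n -> set E) : set (n.-tuple E) :=
  [set x | forall i, B i (tnth x i)].

Lemma measurable_tuple_box (B : 'I_n -> set E) :
  (forall i, measurable (B i)) -> measurable (tuple_box B).
Proof.
move=> mB; have -> : tuple_box B = \bigcap_(i in [set: 'I_n]) ((@tnth n E)^~ i @^-1` B i).
  by apply/seteqP; split => x /= H i; [move=> _; exact: H|exact: H].
apply: fin_bigcap_measurable; first exact: finite_finset.
by move=> i _; rewrite -[X in measurable X]setTI; exact: measurable_tnth.
Qed.

(** Boxes, unlike the coordinate preimages that define the sigma-algebra, are closed under
    intersection, as uniqueness of measures requires. *)
Lemma measurable_tuple_boxE :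
  measurable = <<s [set A : set (n.-tuple E) |
     exists2 B : 'I_n -> set E, (forall i, measurable (B i)) & A = tuple_box B] >>.
Proof.
apply/seteqP; split; last first.
  apply: smallest_sub; first exact: sigma_algebra_measurable.
  by move=> A [B mB ->]; exact: measurable_tuple_box.
move=> A; apply: smallest_sub; first exact: smallest_sigma_algebra.
rewrite -bigcup_seq/= => {}A [i _ [Y mY <-]]; apply: sub_sigma_algebra.
exists (fun j => if j == i then Y else setT); first by move=> j; case: ifP.
apply/seteqP; split => x /=.
  by move=> [_ Yx] j; case: eqP => // ->.
by move=> /(_ i); rewrite eqxx.
Qed.

Lemma tuple_measure_unique (m1 m2 : {measure set (n.-tuple E) -> \bar R}) :
  (m1 setT < +oo)%E ->
  (forall B, (forall i, measurable (B i)) -> m1 (tuple_box B) = m2 (tuple_box B)) ->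
  forall A, measurable A -> m1 A = m2 A.
Proof.
move=> m1fin m12; apply: (measure_unique _ (fun=> setT) measurable_tuple_boxE) => //.
- move=> _ _ [B mB ->] [B' mB' ->]; exists (fun i => B i `&` B' i).
    by move=> i; exact: measurableI.
  apply/seteqP; split => x /=; first by move=> [H H'] i; split.
  by move=> H; split=> i; have [] := H i.
- by move=> _; exists (fun=> setT) => //; apply/seteqP; split.
- by apply/seteqP; split => // x _; exists 0%N.
- by move=> A [B mB ->]; exact: m12.
Qed.

(** Integrating over [y] plays the part of conditioning on all coordinates but the [i]-th. *)
Definition upd (x : n.-tuple E) (i : 'I_n) (y : E) : n.-tuple E :=
  [tuple if j == i then y else tnth x j | j < n].

Lemma tnth_upd x i y j : tnth (upd x i y) j = if j == i then y else tnth x j.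
Proof. by rewrite tnth_mktuple. Qed.

Lemma measurable_upd i : measurable_fun setT (fun z : n.-tuple E * E => upd z.1 i z.2).
Proof.
apply/measurable_fun_tnthP => j.
rewrite [X in measurable_fun _ X](_ : _ =
  fun z : n.-tuple E * E => if j == i then z.2 else tnth z.1 j); last first.
  by apply/funext => z /=; rewrite tnth_upd.
case: (j == i); first exact: measurable_snd.
by apply: (@measurableT_comp _ _ _ _ _ _ (fun x => tnth x j)) => //; exact: measurable_tnth.
Qed.

End tuple_law.

(** * Resampling one coordinate of a product law *)

Section resampling.
Context d (E : measurableType d) (R : realType) (n : nat).
Variables (F : probability E R) (mu : probability (n.-tuple E) R).
Hypothesis muE : forall B : 'I_n -> set E, (forall i, measurable (B i)) ->
  mu (tuple_box B) = (\prod_(i < n) F (B i))%E.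
Local Open Scope ereal_scope.

(** The image of [mu \x F] under [upd] gives each box the mass that [mu] gives it: the preimage of a
    box frees its [i]-th side and moves that constraint to the new variable. Tonelli does the
    rest. *)
Lemma integral_upd (i : 'I_n) (phi : n.-tuple E -> \bar R) :
  measurable_fun [set: n.-tuple E] phi -> (forall x, 0 <= phi x) ->
  \int[mu]_x phi x = \int[mu]_x \int[F]_y phi (upd x i y).
Proof.
move=> mphi phi0.
have mU := @measurable_upd _ E n i.
pose U (z : n.-tuple E * E) := upd z.1 i z.2.
transitivity (\int[pushforward (mu \x F) U]_x phi x).
  apply: eq_measure_integral => A mA _; apply: tuple_measure_unique => //=.
    exact: le_lt_trans (probability_le1 mu measurableT) (ltry _).
  move=> B mB; rewrite muE// /pushforward.
  have -> : U @^-1` tuple_box B =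
      tuple_box (fun j => if j == i then setT else B j) `*` B i.
    apply/seteqP; split => -[x y] /=.
      move=> H; split; last by have := H i; rewrite tnth_upd eqxx.
      by move=> j; have := H j; rewrite tnth_upd; case: ifP.
    by move=> [H Bi] j; have := H j; rewrite tnth_upd; case: eqP => // ->.
  have mB' j : measurable (if j == i then setT else B j) by case: ifP.
  have mb := measurable_tuple_box mB'.
  rewrite product_measure1E//.
  transitivity ((\prod_(j < n) F (if j == i then setT else B j)) * F (B i)).
    rewrite (bigD1 i)//= [in RHS](bigD1 i)//= eqxx probability_setT mul1e muleC.
    by congr (_ * _); apply: eq_bigr => j /negbTE ->.
  by rewrite -(muE mB').
rewrite ge0_integral_pushforward//=.
rewrite preimage_setT (fubini_tonelli1 (phi \o U))//=.
exact: measurableT_comp.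
Qed.
End resampling.

(** * Symmetrisation of degenerate sums *)

Lemma measurable_bigmaxr d (T : measurableType d) (R : realType) (I : Type)
    (s : seq I) (P : pred I) (h : I -> T -> R) :
  (forall i, measurable_fun setT (h i)) ->
  measurable_fun setT (fun x => \big[Num.max/0]_(i <- s | P i) h i x).
Proof.
move=> mh; elim: s => [|i s IH].
  by under eq_fun do rewrite big_nil; exact: measurable_cst.
under eq_fun do rewrite big_cons.
by case: (P i) => //; exact: measurable_maxr.
Qed.

Definition maxabs (R : realType) (J : finType) (v : J -> R) : R :=
  \big[Num.max/0]_j `|v j|.

Section maxabs_theory.
Context (R : realType) (J : finType).
Implicit Types v w : J -> R.

Lemma maxabs_ge0 v : 0 <= maxabs v. Proof. exact: bigmax_ge_id. Qed.

Lemma le_maxabs v j : `|v j| <= maxabs v.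
Proof. exact: (le_bigmax _ (fun j => `|v j|)). Qed.

Lemma maxabs_le v (c : R) : 0 <= c -> (forall j, `|v j| <= c) -> maxabs v <= c.
Proof. by move=> c0 vc; exact: bigmax_le. Qed.

End maxabs_theory.

Section random_kernel.
Context d (E : measurableType d) (R : realType) (n : nat).
Variables (F : probability E R) (mu : probability (n.-tuple E) R).
Hypothesis muE : forall B : 'I_n -> set E, (forall i, measurable (B i)) ->
  mu (tuple_box B) = (\prod_(i < n) F (B i))%E.
Variables (J : finType) (f : J -> E -> E -> R).
Hypothesis mf : forall j, measurable_fun [set: E * E] (fun z => f j z.1 z.2).

(** With free coefficients on ordered pairs, both multiplying by signs and restricting to a set of
    indices act on [c] alone. *)
Definition chaos (c : 'I_n * 'I_n -> R) (x : n.-tuple E) (j : J) : R :=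
  \sum_ab c ab * f j (tnth x ab.1) (tnth x ab.2).

Lemma measurable_kernel_tnth j (a b : 'I_n) :
  measurable_fun [set: n.-tuple E] (fun x => f j (tnth x a) (tnth x b)).
Proof.
apply: (@measurableT_comp _ _ _ _ _ _ (fun z : E * E => f j z.1 z.2) _
  (fun x : n.-tuple E => (tnth x a, tnth x b))); first exact: mf.
by apply: measurable_fun_pair; exact: measurable_tnth.
Qed.

Lemma measurable_chaos c j : measurable_fun [set: n.-tuple E] (chaos c ^~ j).
Proof.
apply: measurable_sum => ab; apply: measurable_funM => //.
exact: measurable_kernel_tnth.
Qed.

Lemma measurable_maxabs (G : J -> n.-tuple E -> R) :
  (forall j, measurable_fun setT (G j)) ->
  measurable_fun [set: n.-tuple E] (fun x => maxabs (G ^~ x)).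
Proof.
move=> mG; apply: measurable_bigmaxr => j.
by apply: measurableT_comp => //; exact: normr_measurable.
Qed.

Lemma measurable_upd_coord (x : n.-tuple E) i : measurable_fun setT (upd x i).
Proof.
apply/measurable_fun_tnthP => j.
rewrite [X in measurable_fun _ X](_ : _ = fun y => if j == i then y else tnth x j).
  by case: (j == i).
by apply/funext => y /=; rewrite tnth_upd.
Qed.

Local Open Scope ereal_scope.

(** Jensen's inequality for the maximum norm in the [i]-th coordinate: each [H j] is an average of
    [G j] over that coordinate, and resampling restores the integral of the norm of [G]. *)
Lemma integral_maxabs_upd_le i (G H : J -> n.-tuple E -> R) :
  (forall j, measurable_fun setT (G j)) -> (forall j, measurable_fun setT (H j)) ->
  (forall j x, \int[F]_y (G j (upd x i y))%:E = (H j x)%:E) ->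
  \int[mu]_x (maxabs (H ^~ x))%:E <= \int[mu]_x (maxabs (G ^~ x))%:E.
Proof.
move=> mG mH GH.
have mNG := measurable_maxabs mG.
rewrite [leRHS](integral_upd muE i); first last.
- by move=> x; rewrite lee_fin maxabs_ge0.
- exact/measurable_EFinP.
have mNU : measurable_fun [set: n.-tuple E * E]
    (fun z => (maxabs (G ^~ (upd z.1 i z.2)))%:E).
  apply/measurable_EFinP; apply: (measurableT_comp mNG); exact: measurable_upd.
apply: ge0_le_integral => //.
- by move=> x _; rewrite lee_fin maxabs_ge0.
- by apply/measurable_EFinP; exact: measurable_maxabs.
- exact: (measurable_fun_fubini_tonelli_F _ mNU (fun z => maxabs_ge0 _)).
move=> x _.
have mGx j : measurable_fun setT (fun y => (G j (upd x i y))%:E).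
  by apply/measurable_EFinP; apply: measurableT_comp => //; exact: measurable_upd_coord.
have mNx : measurable_fun setT (fun y => (maxabs (G ^~ (upd x i y)))%:E).
  by apply/measurable_EFinP; apply: (measurableT_comp mNG); exact: measurable_upd_coord.
have I0 : 0 <= \int[F]_y (maxabs (G ^~ (upd x i y)))%:E.
  by apply: integral_ge0 => y _; rewrite lee_fin maxabs_ge0.
have : forall j, `|H j x|%:E <= \int[F]_y (maxabs (G ^~ (upd x i y)))%:E.
  move=> j; rewrite -abse_EFin -GH; apply: le_trans (le_abse_integral F measurableT (mGx j)) _.
  apply: ge0_le_integral => //; first exact: measurableT_comp.
  by move=> y _; rewrite lee_fin (le_maxabs (G ^~ _)).
move: I0; case: (\int[F]_y _) => [r|_ _|//]; last by rewrite leey.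
by rewrite !lee_fin => r0 Hr; apply: maxabs_le => // j; rewrite -lee_fin.
Qed.

Hypothesis fl0 : forall j x, \int[F]_y (f j x y)%:E = 0.
Hypothesis fr0 : forall j y, \int[F]_x (f j x y)%:E = 0.

(** Were the positive and negative parts both of infinite integral, the difference would be [-oo] by
    convention; an integral equal to 0 therefore forces integrability, here on every section of the
    kernel. *)
Lemma integrable_kernel (g : E -> R) : measurable_fun setT g ->
  \int[F]_y (g y)%:E = 0 -> F.-integrable setT (EFin \o g).
Proof.
move=> mg g0; have mg' : measurable_fun setT (EFin \o g) by exact/measurable_EFinP.
apply/integrableP; split => //.
by apply/(abse_integralP F measurableT mg'); rewrite g0 abse0 ltry.
Qed.

Definition restr (S : pred 'I_n) (c : 'I_n * 'I_n -> R) (ab : 'I_n * 'I_n) : R :=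
  if S ab.1 && S ab.2 then c ab else 0%R.

(* A degenerate kernel integrates to zero in either argument, so integrating out the coordinate
   [i] kills exactly the terms that involve it. *)
Lemma integral_chaos_upd i c j x : (forall a, c (a, a) = 0%R) ->
  \int[F]_y (chaos c (upd x i y) j)%:E = (chaos (restr (predC1 i) c) x j)%:E.
Proof.
move=> c0.
pose h (ab : 'I_n * 'I_n) y :=
  (c ab * f j (tnth (upd x i y) ab.1) (tnth (upd x i y) ab.2))%R.
have mfx u : measurable_fun setT (f j u).
  exact: (measurableT_comp (mf j) (pair1_measurable u)).
have mfy u : measurable_fun setT (f j ^~ u).
  exact: (measurableT_comp (mf j) (pair2_measurable u)).
have key ab : F.-integrable setT (EFin \o h ab) /\
    \int[F]_y (h ab y)%:E = (restr (predC1 i) c ab * f j (tnth x ab.1) (tnth x ab.2))%:E.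
  (* On the diagonal both arguments are resampled at once and degeneracy says nothing; there the
     coefficient is zero. *)
  case: ab => a b; rewrite /restr /=; have [->|ab] := eqVneq a b.
    rewrite c0 if_same mul0r; have -> : h (b, b) = cst 0%R.
      by apply/funext => y; rewrite /h c0 mul0r.
    by split; [exact: finite_measure_integrable_cst|rewrite integral0_eq].
  have hE y : h (a, b) y = (c (a, b) * f j (if a == i then y else tnth x a)
     (if b == i then y else tnth x b))%R by rewrite /h !tnth_upd.
  have zero (g : E -> R) : h (a, b) = (fun y => c (a, b) * g y)%R ->
      measurable_fun setT g -> \int[F]_y (g y)%:E = 0 ->
      F.-integrable setT (EFin \o h (a, b)) /\ \int[F]_y (h (a, b) y)%:E = 0.
    move=> -> mg g0; have ig := integrable_kernel mg g0; split.
      exact: (integrableZl measurableT _ ig).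
    under eq_integral do rewrite EFinM.
    by rewrite integralZl// g0 mule0.
  have [ai|ai] := eqVneq a i; have [bi|bi] := eqVneq b i.
  - by rewrite ai bi eqxx in ab.
  - rewrite /= mul0r; apply: (zero (f j ^~ (tnth x b))) => //.
    by apply/funext => y; rewrite hE ai eqxx (negbTE bi).
  - rewrite /= mul0r; apply: (zero (f j (tnth x a))) => //.
    by apply/funext => y; rewrite hE bi eqxx (negbTE ai).
  - have -> : h (a, b) = cst (c (a, b) * f j (tnth x a) (tnth x b))%R.
      by apply/funext => y; rewrite hE (negbTE ai) (negbTE bi).
    split; first exact: finite_measure_integrable_cst.
    have := integral_cst F measurableT (c (a, b) * f j (tnth x a) (tnth x b))%:E.
    by move=> ->; rewrite -[RHS]mule1; congr (_ * _); exact: probability_setT.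
rewrite /chaos -sumEFin; under eq_integral do rewrite -sumEFin.
rewrite (@integral_sum _ _ _ F setT measurableT _ (fun ab y => (h ab y)%:E)).
  by apply: eq_bigr => ab _; have [] := key ab.
by move=> ab; have [] := key ab.
Qed.

Lemma integral_maxabs_chaos_restr_seq (s : seq 'I_n) c : (forall a, c (a, a) = 0%R) ->
  \int[mu]_x (maxabs (chaos (restr (predC (mem s)) c) x))%:E <=
  \int[mu]_x (maxabs (chaos c x))%:E.
Proof.
elim: s c => [|i s IH] c c0.
  have -> // : restr (predC (mem [::])) c = c by apply/funext => ab.
apply: le_trans (IH c c0).
have -> : restr (predC (mem (i :: s))) c = restr (predC1 i) (restr (predC (mem s)) c).
  apply/funext => ab; rewrite /restr /= !inE !negb_or.
  by case: (ab.1 == i); case: (ab.2 == i); rewrite //= ?andbF.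
have mc c' j := @measurable_chaos c' j.
apply: (@integral_maxabs_upd_le i (fun j x => chaos _ x j) (fun j x => chaos _ x j)) => // j x.
rewrite integral_chaos_upd// => a; by rewrite /restr c0 if_same.
Qed.

Lemma integral_maxabs_chaos_restr (S : {pred 'I_n}) c : (forall a, c (a, a) = 0%R) ->
  \int[mu]_x (maxabs (chaos (restr S c) x))%:E <= \int[mu]_x (maxabs (chaos c x))%:E.
Proof.
move=> c0; have := integral_maxabs_chaos_restr_seq (enum (predC S)) c0.
have -> // : restr (predC (mem (enum (predC S)))) c = restr S c.
by apply/funext => ab; rewrite /restr /= !mem_enum !inE !negbK.
Qed.

Lemma chaosD c1 c2 x j : chaos (fun ab => c1 ab + c2 ab)%R x j = (chaos c1 x j + chaos c2 x j)%R.
Proof. by rewrite /chaos -big_split; apply: eq_bigr => ab _; rewrite mulrDl. Qed.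

Lemma chaosZ k c x j : chaos (fun ab => k * c ab)%R x j = (k * chaos c x j)%R.
Proof. by rewrite /chaos big_distrr /=; apply: eq_bigr => ab _; rewrite mulrA. Qed.

Lemma integral_maxabs_chaos_signs (e : 'I_n -> R) c : (forall a, c (a, a) = 0%R) ->
  (forall i, e i = 1 \/ e i = -1)%R ->
  \int[mu]_x (maxabs (chaos c x))%:E <=
  5%:E * \int[mu]_x (maxabs (chaos (fun ab => c ab * (e ab.1 * e ab.2))%R x))%:E.
Proof.
move=> c0 e1; set c' := fun ab : 'I_n * 'I_n => (c ab * _)%R.
have c'0 a : c' (a, a) = 0%R by rewrite /c' c0 mul0r.
pose S : {pred 'I_n} := [pred i | e i == 1%R].
have mN c'' : measurable_fun [set: n.-tuple E] (fun x => maxabs (chaos c'' x)).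
  by apply: (@measurable_maxabs (fun j x => chaos c'' x j)) => j; exact: measurable_chaos.
have mNE c'' : measurable_fun [set: n.-tuple E] (fun x => (maxabs (chaos c'' x))%:E).
  exact/measurable_EFinP.
(* The constant is 5 = 2 + 2 + 1: each block enters with weight 2, the whole signed chaos with
   weight 1. *)
apply: (@le_trans _ _ (2%:E * \int[mu]_x (maxabs (chaos (restr S c') x))%:E +
   2%:E * \int[mu]_x (maxabs (chaos (restr (predC S) c') x))%:E +
   \int[mu]_x (maxabs (chaos c' x))%:E)); last first.
  set I := \int[mu]_x (maxabs (chaos c' x))%:E.
  have I0 : 0 <= I by apply: integral_ge0 => x _; rewrite lee_fin maxabs_ge0.
  have -> : 5%:E * I = 2%:E * I + 2%:E * I + I.
    case: I I0 => [r _||] //; first by rewrite -!EFinM -!EFinD; congr EFin; ring.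
    by rewrite !gt0_muley ?lte_fin.
  rewrite leeD2r// leeD// lee_wpmul2l//; exact: integral_maxabs_chaos_restr.
have N0 c'' : forall x, setT x -> 0 <= (maxabs (chaos c'' x))%:E.
  by move=> x _; rewrite lee_fin maxabs_ge0.
have N2 c'' : forall x, setT x -> 0 <= 2%:E * (maxabs (chaos c'' x))%:E.
  by move=> x _; rewrite mule_ge0// lee_fin maxabs_ge0.
have m2 c'' : measurable_fun [set: n.-tuple E] (fun x => 2%:E * (maxabs (chaos c'' x))%:E).
  exact: measurable_funeM.
have m4 c1 c2 : measurable_fun [set: n.-tuple E]
    (fun x => 2%:E * (maxabs (chaos c1 x))%:E + 2%:E * (maxabs (chaos c2 x))%:E).
  exact: emeasurable_funD.
have N4 c1 c2 : forall x, setT x ->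
    0 <= 2%:E * (maxabs (chaos c1 x))%:E + 2%:E * (maxabs (chaos c2 x))%:E.
  by move=> x _; rewrite adde_ge0// N2.
have Z2 c'' : 2%:E * \int[mu]_x (maxabs (chaos c'' x))%:E =
    \int[mu]_x (2%:E * (maxabs (chaos c'' x))%:E).
  by rewrite ge0_integralZl//; exact: N0.
rewrite !Z2 -(ge0_integralD mu measurableT (N2 _) (m2 _) (N2 _) (m2 _)).
rewrite -(ge0_integralD mu measurableT (N4 _ _) (m4 _ _) (N0 _) (mNE _)).
apply: ge0_le_integral => //.
- exact: N0.
- exact: emeasurable_funD.
move=> x _; rewrite -!EFinM -!EFinD lee_fin; apply: maxabs_le.
  by rewrite !addr_ge0 ?mulr_ge0 ?maxabs_ge0.
(* The blocks carry the signed coefficients, so that they are restrictions of the signed chaos.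
   Inside either block [c'] equals [c], which gives [2 * c - c]; on mixed pairs [c'] is the opposite
   of [c], and only the last term is left. *)
move=> j; have -> : c = (fun ab => (2 * restr S c' ab + 2 * restr (predC S) c' ab) + -1 * c' ab)%R.
  apply/funext => -[a b]; rewrite /restr /c' /S /=.
  have nt : (-1 == 1 :> R)%R = false by apply: lt_eqF; lra.
  by case: (e1 a) => ->; case: (e1 b) => ->; rewrite ?inE ?eqxx ?nt /=; ring.
rewrite !chaosD !chaosZ.
have := le_maxabs (chaos (restr S c') x) j.
have := le_maxabs (chaos (restr (predC S) c') x) j.
have := le_maxabs (chaos c' x) j.
rewrite !ler_norml => /andP[? ?] /andP[? ?] /andP[? ?]; apply/andP; split; lra.
Qed.

End random_kernel.

Lemma sume_const_seq (R : realType) (I : Type) (s : seq I) (x : \bar R) :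
  (0 <= x)%E -> (\sum_(i <- s) x = (size s)%:R%:E * x)%E.
Proof.
move=> x0; elim: s => [|i s IH]; first by rewrite big_nil mul0e.
by rewrite big_cons IH /= -natr1 EFinD ge0_muleDl ?lee_fin// mul1e addeC.
Qed.

Lemma integral_cst_probability d (T : measurableType d) (R : realType)
    (P : probability T R) (r : \bar R) : (\int[P]_x r = r)%E.
Proof.
have := integral_cst P measurableT r.
by move=> ->; rewrite -[RHS]mule1; congr (_ * _)%E; exact: probability_setT.
Qed.

(** * Averaging over the signs *)

Section chaos_bound.
Context d (E : measurableType d) (R : realType) (n : nat).
Variables (F : probability E R) (mu : probability (n.-tuple E) R).
Hypothesis muE : forall B : 'I_n -> set E, (forall i, measurable (B i)) ->
  mu (tuple_box B) = (\prod_(i < n) F (B i))%E.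
Variables (J : finType) (f : J -> E -> E -> R).
Hypothesis mf : forall j, measurable_fun [set: E * E] (fun z => f j z.1 z.2).
Hypothesis J0 : (0 < #|J|)%N.
Local Open Scope ereal_scope.
Hypothesis fl0 : forall j x, \int[F]_y (f j x y)%:E = 0.
Hypothesis fr0 : forall j y, \int[F]_x (f j x y)%:E = 0.

(** Given the sample, this is the common bound on the squared Frobenius norms of the quadratic forms
    in the signs. *)
Definition chaos_var (c : 'I_n * 'I_n -> R) (x : n.-tuple E) : R :=
  \big[Num.max/0%R]_j (\sum_ab (c ab * f j (tnth x ab.1) (tnth x ab.2)) ^+ 2)%R.

Lemma chaos_var_ge0 c x : (0 <= chaos_var c x)%R. Proof. exact: bigmax_ge_id. Qed.

Lemma measurable_chaos_var c : measurable_fun [set: n.-tuple E] (chaos_var c).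
Proof.
apply: measurable_bigmaxr => j; apply: measurable_sum => ab.
by apply: measurable_funX; apply: measurable_funM => //; exact: measurable_kernel_tnth.
Qed.

(** The comparison with a signed chaos holds for each fixed sign vector, hence may be summed over
    all of them; after exchanging sum and integral, the Rademacher bound applies at every sample
    point, with [S] the value of [chaos_var] there. *)
Lemma integral_maxabs_chaos_le c th : (0 < th)%R -> (forall a, c (a, a) = 0%R) ->
  \int[mu]_x (maxabs (chaos f c x))%:E <=
  (5 * (ln #|J|%:R + 2 * expR (10 / 256)))%:E *
    (th%:E + (64 / th)%:E * \int[mu]_x (chaos_var c x)%:E).
Proof.
move=> th0 c0; set I := \int[mu]_x _; set C := (_ + _)%R.
pose c_ (e : seq R) (ab : 'I_n * 'I_n) := (c ab * (e`_ab.1 * e`_ab.2))%R.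
have C0 : (0 <= C)%R by rewrite addr_ge0 ?mulr_ge0 ?expR_ge0// ln_ge0// ler1n.
have I0 : 0 <= I by apply: integral_ge0 => x _; rewrite lee_fin maxabs_ge0.
have p0 : (0 < (2 ^+ n : R))%R by rewrite exprn_gt0.
have mN c' : measurable_fun [set: n.-tuple E] (fun x => (maxabs (chaos f c' x))%:E).
  apply/measurable_EFinP; apply: (@measurable_maxabs _ _ _ _ _ (fun j x => chaos f c' x j)) => j.
  exact: measurable_chaos.
have N0 c' x : 0 <= (maxabs (chaos f c' x))%:E by rewrite lee_fin maxabs_ge0.
have th64 : (0 <= 64 / th)%R by rewrite divr_ge0// ltW.
have mV : measurable_fun [set: n.-tuple E] (fun x => (chaos_var c x)%:E).
  by apply/measurable_EFinP; exact: measurable_chaos_var.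
have V0 x : 0 <= (chaos_var c x)%:E by rewrite lee_fin chaos_var_ge0.
rewrite -(@lee_pmul2l _ (2 ^+ n)%:E)// ?lte_fin//.
apply: (@le_trans _ _ (5%:E * \sum_(e <- signs R n) \int[mu]_x (maxabs (chaos f (c_ e) x))%:E)).
  rewrite ge0_sume_distrr; last by move=> e _; exact: integral_ge0.
  rewrite -[X in X%:E * I](_ : (size (signs R n))%:R = _)%R; last by rewrite size_signs natrX.
  rewrite -sume_const_seq// !big_seq; apply: lee_sum => e eS.
  have e1 (i : 'I_n) : e`_i = 1%R \/ e`_i = (-1)%R by exact: signsP eS.
  exact: (integral_maxabs_chaos_signs muE mf fl0 fr0 c0 e1).
rewrite -ge0_integral_sum//.
apply: (@le_trans _ _ (5%:E * \int[mu]_x ((2 ^+ n * C)%:E * (th%:E + (64 / th)%:E * (chaos_var c x)%:E)))).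
  rewrite lee_wpmul2l//; apply: ge0_le_integral => //.
  - by move=> x _; apply: sume_ge0.
  - exact: emeasurable_sum.
  - apply: measurable_funeM; apply: emeasurable_funD => //; exact: measurable_funeM.
  move=> x _; rewrite sumEFin [leRHS](_ : _ = (2 ^+ n * C * (th + 64 / th * chaos_var c x))%:E)// lee_fin.
  pose a j i k := (c (i, k) * f j (tnth x i) (tnth x k))%R.
  have a0 j i : a j i i = 0%R by rewrite /a c0 mul0r.
  have aV j : (\sum_i \sum_k a j i k ^+ 2 <= chaos_var c x)%R.
    rewrite pair_bigA /=.
    have := le_bigmax 0%R (fun j => \sum_ab (c ab * f j (tnth x ab.1) (tnth x ab.2)) ^+ 2)%R j.
    by apply: le_trans; rewrite le_eqVlt; apply/orP; left; apply/eqP; apply: eq_bigr => -[].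
  have := rademacher_chaos_max J0 th0 a0 aV.
  have -> : (64 * chaos_var c x / th = 64 / th * chaos_var c x)%R by rewrite mulrAC.
  rewrite (mulrA (2 ^+ n)%R); apply: le_trans.
  rewrite le_eqVlt; apply/orP; left; apply/eqP.
  apply: eq_bigr => e _; apply: eq_bigr => j _; congr (`| _ |)%R.
  by rewrite pair_bigA /=; apply: eq_bigr => -[i k] _; rewrite /c_ /a /= mulrAC.
have mA : measurable_fun [set: n.-tuple E] (fun x => (64 / th)%:E * (chaos_var c x)%:E).
  exact: measurable_funeM.
have A0 x : [set: n.-tuple E] x -> 0 <= (64 / th)%:E * (chaos_var c x)%:E.
  by move=> _; rewrite mule_ge0// lee_fin.
rewrite ge0_integralZl//; first last.
- by rewrite lee_fin mulr_ge0// ltW.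
- by move=> x _; rewrite adde_ge0 ?A0// lee_fin ltW.
- exact: emeasurable_funD.
rewrite ge0_integralD//; last by move=> x _; rewrite lee_fin ltW.
rewrite ge0_integralZl//.
have -> : \int[mu]_x th%:E = th%:E.
  exact: integral_cst_probability.
rewrite !muleA -!EFinM; set Z := (X in _ * X <= _).
have -> // : (5 * (2 ^+ n * C) = 2 ^+ n * (5 * C))%R by ring.
Qed.

End chaos_bound.

(** * Sums along a matching *)

(** The condition [uniq (endpoints s)] expresses that [s] is a matching: no loops and no shared
    vertices. *)
Definition endpoints (I : Type) (s : seq (I * I)) : seq I :=
  flatten [seq [:: l.1; l.2] | l <- s].

Lemma mem_endpoints (I : eqType) (s : seq (I * I)) (l : I * I) : l \in s ->
  l.1 \in endpoints s /\ l.2 \in endpoints s.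
Proof.
by move=> ls; split; apply/flatten_mapP; exists l; rewrite // !inE eqxx ?orbT.
Qed.

Lemma uniq_endpoints_neq (I : eqType) (s : seq (I * I)) (l : I * I) :
  uniq (endpoints s) -> l \in s -> l.1 != l.2.
Proof.
elim: s => //= k s IH /andP[+ /andP[_ us]]; rewrite inE negb_or => /andP[k12 _].
by rewrite inE => /predU1P[->//|]; exact: IH.
Qed.

Section matching.
Context d (E : measurableType d) (R : realType) (n : nat).
Variables (F : probability E R) (mu : probability (n.-tuple E) R).
Hypothesis muE : forall B : 'I_n -> set E, (forall i, measurable (B i)) ->
  mu (tuple_box B) = (\prod_(i < n) F (B i))%E.
Implicit Types (s : seq ('I_n * 'I_n)) (l : 'I_n * 'I_n) (x : n.-tuple E).

Definition at_pair x l : E * E := (tnth x l.1, tnth x l.2).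

Lemma measurable_at_pair l : measurable_fun setT (at_pair ^~ l).
Proof. by apply: measurable_fun_pair; exact: measurable_tnth. Qed.

Lemma measurable_comp_at_pair (phi : E * E -> R) l : measurable_fun setT phi ->
  measurable_fun setT (fun x => phi (at_pair x l)).
Proof. by move=> mphi; apply: (measurableT_comp mphi); exact: measurable_at_pair. Qed.

Lemma at_pair_upd x i y l : i != l.1 -> i != l.2 -> at_pair (upd x i y) l = at_pair x l.
Proof. 
rewrite ![i == _]eq_sym => /negbTE i1 /negbTE i2.
by rewrite /at_pair !tnth_upd i1 i2. Qed.

Local Open Scope ereal_scope.

(** Independence of [psi] from the pair is expressed as invariance under resampling its two
    endpoints. Resampling them one after the other turns [phi] into its double integral. *)
Lemma integral_at_pair l (phi : E * E -> \bar R) (psi : n.-tuple E -> \bar R) :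
  l.1 != l.2 ->
  measurable_fun [set: E * E] phi -> (forall z, 0 <= phi z) ->
  measurable_fun [set: n.-tuple E] psi -> (forall x, 0 <= psi x) ->
  (forall x y, psi (upd x l.1 y) = psi x) -> (forall x y, psi (upd x l.2 y) = psi x) ->
  \int[mu]_x (phi (at_pair x l) * psi x) = \int[F \x F]_z phi z * \int[mu]_x psi x.
Proof.
case: l => a b /= ab mphi phi0 mpsi psi0 psia psib.
have mphil : measurable_fun [set: n.-tuple E] (fun x => phi (at_pair x (a, b))).
  by apply: (measurableT_comp mphi); exact: measurable_at_pair.
rewrite (integral_upd muE a); first last.
- by move=> x; rewrite mule_ge0.
- exact: emeasurable_funM.
pose phi1 z := \int[F]_y phi (y, z).
have phi10 z : 0 <= phi1 z by exact: integral_ge0.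
have mphi1 : measurable_fun setT phi1 by exact: measurable_fun_fubini_tonelli_G.
transitivity (\int[mu]_x (phi1 (tnth x b) * psi x)).
  apply: eq_integral => x _.
  under eq_integral => y _.
    rewrite psia (_ : at_pair _ _ = (y, tnth x b)); last first.
      by rewrite /at_pair /= !tnth_upd eqxx eq_sym (negbTE ab).
    over.
  rewrite ge0_integralZr//; exact: (measurableT_comp mphi (pair2_measurable _)).
rewrite (integral_upd muE b); first last.
- by move=> x; rewrite mule_ge0.
- by apply: emeasurable_funM => //; apply: (measurableT_comp mphi1); exact: measurable_tnth.
rewrite fubini_tonelli2// -ge0_integralZl//; last exact: integral_ge0.
apply: eq_integral => x _.
under eq_integral => y _ do rewrite psib tnth_upd eqxx.
by rewrite ge0_integralZr.
Qed.

Lemma integral_at_pair1 l (phi : E * E -> \bar R) : l.1 != l.2 ->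
  measurable_fun [set: E * E] phi -> (forall z, 0 <= phi z) ->
  \int[mu]_x phi (at_pair x l) = \int[F \x F]_z phi z.
Proof.
move=> l12 mphi phi0; under eq_integral do rewrite -[phi _]mule1.
by rewrite (@integral_at_pair l phi (cst 1))// integral_cst_probability mule1.
Qed.

Lemma integral_prod_at_pair s (phi : E * E -> R) (K : R) : uniq (endpoints s) ->
  measurable_fun [set: E * E] phi -> (forall z, 0 <= phi z)%R ->
  \int[F \x F]_z (phi z)%:E = K%:E ->
  \int[mu]_x (\prod_(l <- s) phi (at_pair x l))%:E = (K ^+ size s)%:E.
Proof.
move=> + mphi phi0 KE; elim: s => [_|l s IH /= /andP[+ /andP[l2s us]]].
  under eq_integral do rewrite big_nil; rewrite expr0.
  exact: integral_cst_probability.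
rewrite inE negb_or => /andP[l12 l1s].
under eq_integral do rewrite big_cons EFinM.
pose psi x := (\prod_(l <- s) phi (at_pair x l))%:E.
have inv i y x : i \notin endpoints s -> psi (upd x i y) = psi x.
  move=> ni; rewrite /psi !big_seq; congr EFin; apply: eq_bigr => k ks.
  rewrite at_pair_upd//; have [k1 k2] := mem_endpoints ks.
    by apply: contraNneq ni => ->.
  by apply: contraNneq ni => ->.
rewrite (@integral_at_pair l (EFin \o phi) psi)//=.
- by rewrite KE IH// -EFinM exprS.
- exact/measurable_EFinP.
- apply/measurable_EFinP; apply: measurable_prod => k _.
  exact: measurable_comp_at_pair.
- by move=> x; rewrite lee_fin prodr_ge0.
- by move=> x y; exact: inv.
- by move=> x y; exact: inv.
Qed.

(* Splitting according to the first pair of [s] at which [M] exceeds [B]. *)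
Lemma first_exceedance_le s (M : E * E -> R) (B q : R) : uniq (endpoints s) ->
  measurable_fun [set: E * E] M -> (forall z, 0 <= M z)%R -> (0 <= q <= 1)%R ->
  \int[F \x F]_z (if M z <= B then 1 else 0)%R%:E = q%:E ->
  (q ^+ size s)%:E * ((size s)%:R%:E * \int[F \x F]_z (if M z <= B then 0 else M z)%R%:E) <=
  \int[mu]_x (\big[Num.max/0%R]_(l <- s) M (at_pair x l))%:E.
Proof.
move=> + mM M0 /andP[q0 q1] qE; set tau := \int[F \x F]_z _.
have mB : measurable_fun setT (fun z => M z <= B)%R by exact: measurable_fun_ler.
have mlow : measurable_fun setT (fun z => (if M z <= B then 1 else 0)%R : R).
  by apply: measurable_fun_ifT.
have mhigh : measurable_fun setT (fun z => (if M z <= B then 0 else M z)%R : R).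
  by apply: measurable_fun_ifT.
have high0 z : (0 <= if M z <= B then 0 else M z)%R by case: ifP.
have low0 z : (0 <= (if M z <= B then 1 else 0) :> R)%R by case: ifP.
have tau0 : 0 <= tau by apply: integral_ge0 => z _; rewrite lee_fin.
elim: s => [_|l s IH /= /andP[+ /andP[l2s us]]].
  by rewrite mul0e mule0; apply: integral_ge0 => x _; rewrite lee_fin big_nil.
rewrite inE negb_or => /andP[l12 l1s].
pose psi x := (\big[Num.max/0%R]_(l <- s) M (at_pair x l))%:E.
have inv i y x : i \notin endpoints s -> psi (upd x i y) = psi x.
  move=> ni; rewrite /psi !big_seq; congr EFin; apply: eq_bigr => k ks.
  rewrite at_pair_upd//; have [k1 k2] := mem_endpoints ks.
    by apply: contraNneq ni => ->.
  by apply: contraNneq ni => ->.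
have mpsi' : measurable_fun [set: n.-tuple E] (fun x => \big[Num.max/0%R]_(l <- s) M (at_pair x l)).
  by apply: measurable_bigmaxr => k; exact: measurable_comp_at_pair.
have mpsi : measurable_fun [set: n.-tuple E] psi by exact/measurable_EFinP.
have psi0 x : 0 <= psi x by rewrite lee_fin bigmax_ge_id.
have E1 : \int[mu]_x ((if M (at_pair x l) <= B then 0 else M (at_pair x l))%R%:E) = tau.
  apply: (@integral_at_pair1 l (fun z => (if M z <= B then 0 else M z)%R%:E)) => //.
  exact/measurable_EFinP.
have E2 : \int[mu]_x ((if M (at_pair x l) <= B then 1 else 0)%R%:E * psi x) =
    q%:E * \int[mu]_x psi x.
  rewrite (@integral_at_pair l (fun z => (if M z <= B then 1 else 0)%R%:E) psi)//.
  - by rewrite qE.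
  - exact/measurable_EFinP.
  - by move=> x y; exact: inv.
  - by move=> x y; exact: inv.
(* Either the first pair exceeds [B] and contributes [tau], or, with weight [q], the rest of the
   matching takes over. The induction closes because [q ^+ (size s).+1 <= 1] in front of [tau]. *)
apply: (@le_trans _ _ (tau + q%:E * \int[mu]_x psi x)).
  apply: (@le_trans _ _ (tau + q%:E * ((q ^+ size s)%:E * ((size s)%:R%:E * tau)))).
    have qs : (0 <= q ^+ (size s).+1 <= 1)%R by rewrite exprn_ge0//= exprn_ile1.
    case/andP: qs => qs0 qs1; rewrite (muleA q%:E) -EFinM -exprS.
    rewrite -natr1 EFinD ge0_muleDl ?lee_fin// mul1e ge0_muleDr ?mule_ge0 ?lee_fin//.
    rewrite [leRHS]addeC; apply: leeD => //.
    by rewrite -[leRHS]mul1e lee_wpmul2r.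
  by rewrite leeD2l// lee_wpmul2l ?lee_fin// IH.
rewrite -E1 -E2 -ge0_integralD//; first last.
- apply: emeasurable_funM => //; apply/measurable_EFinP.
  exact: (@measurable_comp_at_pair (fun z => if M z <= B then 1 else 0)%R).
- by move=> x _; rewrite mule_ge0// lee_fin.
- by apply/measurable_EFinP; exact: (@measurable_comp_at_pair (fun z => if M z <= B then 0 else M z)%R).
- by move=> x _; rewrite lee_fin.
apply: ge0_le_integral => //.
- by move=> x _; rewrite adde_ge0 ?mule_ge0// lee_fin.
- apply: emeasurable_funD.
    by apply/measurable_EFinP; exact: (@measurable_comp_at_pair (fun z => if M z <= B then 0 else M z)%R).
  apply: emeasurable_funM => //; apply/measurable_EFinP.
  exact: (@measurable_comp_at_pair (fun z => if M z <= B then 1 else 0)%R).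
- apply/measurable_EFinP; under eq_fun do rewrite big_cons.
  by apply: measurable_maxr => //; exact: measurable_comp_at_pair.
move=> x _; rewrite big_cons /psi; case: ifP => _.
  by rewrite add0e mul1e lee_fin le_max lexx orbT.
by rewrite mul0e adde0 lee_fin le_max lexx.
Qed.

End matching.

Lemma expR_le_linear (R : realType) (u : R) : 0 <= u <= 1 / 2 -> expR u <= 1 + 2 * u.
Proof.
move=> /andP[u0 u1]; have h := expR_ge1Dx (- u).
have h2 : expR u * expR (- u) = 1 by rewrite -expRD subrr expR0.
have e0 := expR_gt0 u.
have : expR u * (1 - u) <= 1 by have := ler_wpM2l (ltW e0) h; rewrite h2.
move=> h3; rewrite -(@ler_pM2r _ (1 - u)); last by lra.
apply: le_trans h3 _; have : 0 <= u * (1 - 2 * u) by rewrite mulr_ge0//; lra.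
lra.
Qed.

(** * Truncation and exponential moments along a matching *)

Section matching_bound.
Context d (E : measurableType d) (R : realType) (n : nat).
Variables (F : probability E R) (mu : probability (n.-tuple E) R).
Hypothesis muE : forall B : 'I_n -> set E, (forall i, measurable (B i)) ->
  mu (tuple_box B) = (\prod_(i < n) F (B i))%E.
Implicit Types (s : seq ('I_n * 'I_n)) (l : 'I_n * 'I_n) (x : n.-tuple E).
Local Open Scope ereal_scope.

Lemma integral_product_cst (r : R) : (0 <= r)%R -> \int[F \x F]_z r%:E = r%:E.
Proof.
move=> r0; rewrite fubini_tonelli1//=; rewrite /fubini_F.
transitivity (\int[F]_x r%:E); last exact: integral_cst_probability.
by apply: eq_integral => x _; exact: integral_cst_probability.
Qed.

(** By Markov's inequality no pair exceeds [2 * A] with probability at least 1/2. By independence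
    this probability is [q ^+ size s], exactly the factor lost in the first-exceedance bound. *)
Lemma integral_exceedance_le s (M : E * E -> R) (A : R) : uniq (endpoints s) ->
  measurable_fun [set: E * E] M -> (forall z, 0 <= M z)%R -> (0 < A)%R ->
  \int[mu]_x (\big[Num.max/0%R]_(l <- s) M (at_pair x l))%:E <= A%:E ->
  (size s)%:R%:E * \int[F \x F]_z (if M z <= 2 * A then 0 else M z)%R%:E <= (2 * A)%:E.
Proof.
move=> us mM M0 A0 MA.
have A20 : (0 < 2 * A)%R by rewrite mulr_gt0.
have mB : measurable_fun setT (fun z => M z <= 2 * A)%R by exact: measurable_fun_ler.
have mlow : measurable_fun setT (fun z => (if M z <= 2 * A then 1 else 0)%R : R).
  by apply: measurable_fun_ifT.
have low0 z : (0 <= (if M z <= 2 * A then 1 else 0) :> R)%R by case: ifP.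
pose I := \int[F \x F]_z (if M z <= 2 * A then 1 else 0)%R%:E.
have I0 : 0 <= I by apply: integral_ge0 => z _; rewrite lee_fin.
have I1 : I <= 1.
  rewrite -(@integral_product_cst 1)//; apply: ge0_le_integral => //.
  - by move=> z _; rewrite lee_fin.
  - exact/measurable_EFinP.
  - by move=> z _; rewrite lee_fin; case: ifP.
have Ifin : I \is a fin_num.
  by rewrite ge0_fin_numE// (le_lt_trans I1)// ltry.
pose q := fine I.
have qE : I = q%:E by rewrite fineK.
have q01 : (0 <= q <= 1)%R.
  by rewrite -!lee_fin -qE I0 I1.
have tail := first_exceedance_le muE us mM M0 q01 qE.
have prodE := integral_prod_at_pair muE us mlow low0 qE.
have mprod : measurable_fun [set: n.-tuple E]
    (fun x => (\prod_(l <- s) (if M (at_pair x l) <= 2 * A then 1 else 0))%R : R).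
  by apply: measurable_prod => l _; exact: (measurable_comp_at_pair _ mlow).
have mmax : measurable_fun [set: n.-tuple E] (fun x => \big[Num.max/0%R]_(l <- s) M (at_pair x l)).
  by apply: measurable_bigmaxr => k; exact: measurable_comp_at_pair.
have half : (1 / 2 <= q ^+ size s)%R.
  (* Pointwise, either all the indicators equal 1, or some pair exceeds [2 * A] and the rescaled
     maximum is at least 1. *)
  have : 1 <= (q ^+ size s)%:E + (2 * A)^-1%:E * A%:E.
    rewrite -(integral_cst_probability mu 1) -prodE.
    apply: (@le_trans _ _ (\int[mu]_x (\prod_(l <- s) (if M (at_pair x l) <= 2 * A then 1 else 0)%R)%:E
       + (2 * A)^-1%:E * \int[mu]_x (\big[Num.max/0%R]_(l <- s) M (at_pair x l))%:E)); last first.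
      by rewrite leeD2l// lee_wpmul2l// lee_fin invr_ge0 ltW.
    rewrite -ge0_integralZl//; first last.
    - by rewrite lee_fin invr_ge0 ltW.
    - by move=> x _; rewrite lee_fin bigmax_ge_id.
    - exact/measurable_EFinP.
    have mm : measurable_fun [set: n.-tuple E]
       (fun x => (2 * A)^-1%:E * (\big[Num.max/0%R]_(l <- s) M (at_pair x l))%:E).
      by apply: measurable_funeM; exact/measurable_EFinP.
    have m0 x : [set: n.-tuple E] x ->
       0 <= (2 * A)^-1%:E * (\big[Num.max/0%R]_(l <- s) M (at_pair x l))%:E.
      by move=> _; rewrite -EFinM lee_fin mulr_ge0 ?bigmax_ge_id// invr_ge0 ltW.
    rewrite -ge0_integralD//; first last.
    - exact/measurable_EFinP.
    - by move=> x _; rewrite lee_fin prodr_ge0.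
    apply: ge0_le_integral => //.
      by apply: emeasurable_funD => //; exact/measurable_EFinP.
    move=> x _; rewrite -EFinM -EFinD lee_fin.
    have [/allP alls|/allPn[l ls]] := boolP (all (fun l => M (at_pair x l) <= 2 * A)%R s).
      rewrite big_seq (eq_bigr (fun=> 1%R)); last by move=> l /alls ->.
      by rewrite big1_eq lerDl mulr_ge0 ?bigmax_ge_id// invr_ge0 ltW.
    rewrite -ltNge => /ltW hl; apply: ler_wpDl; first by rewrite prodr_ge0.
    rewrite ler_pdivlMl// mulr1; apply: le_trans hl _.
    exact: (le_bigmax_seq 0%R l xpredT (fun l => M (at_pair x l)) ls).
  rewrite -EFinM -EFinD lee_fin invfM -mulrA mulVf ?gt_eqF// mulr1; lra.
have := le_trans tail MA; set tau := _ * \int[F \x F]_z _ => h.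
have tau0 : 0 <= tau.
  rewrite mule_ge0 ?lee_fin//; apply: integral_ge0 => z _; rewrite lee_fin; by case: ifP.
have : (1 / 2)%:E * tau <= A%:E.
  by apply: le_trans h; rewrite lee_wpmul2r// lee_fin.
by rewrite -lee_pdivlMl// ?divr_gt0// -EFinM div1r invrK.
Qed.

Variables (J : finType) (g : J -> E -> E -> R).
Hypothesis J0 : (0 < #|J|)%N.
Hypothesis mg : forall j, measurable_fun [set: E * E] (fun z => g j z.1 z.2).
Hypothesis g0 : forall j y z, (0 <= g j y z)%R.

(** Chernoff's method at the scale [2 * B], which keeps each exponent below 1/2: one truncated term
    has exponential moment at most [1 + v / B <= expR (v / B)], and independence along the matching
    multiplies these. The shift [La] adds this exponent to the logarithm of [#|J|], so the sum over
    [J] becomes at most 1. *)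
Lemma integral_max_truncated_le s (B v : R) : uniq (endpoints s) -> (0 < B)%R -> (0 <= v)%R ->
  (forall j, \int[F \x F]_z (g j z.1 z.2)%:E <= v%:E) ->
  \int[mu]_x (\big[Num.max/0%R]_j
     \sum_(l <- s) Num.min (g j (tnth x l.1) (tnth x l.2)) B)%R%:E <=
  (2 * B * (ln #|J|%:R + 1) + 2 * (size s)%:R * v)%:E.
Proof.
move=> us B0 v0 gv.
pose t j z := Num.min (g j z.1 z.2) B.
have mt j : measurable_fun [set: E * E] (t j) by exact: measurable_minr.
have t0 j z : (0 <= t j z)%R by rewrite le_min g0 ltW.
have tB j z : (t j z <= B)%R by rewrite ge_min lexx orbT.
pose phi j z := expR (t j z / (2 * B)).
have mphi j : measurable_fun [set: E * E] (phi j).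
  by apply: measurableT_comp => //; exact: measurable_funM.
have phi0 j z : (0 <= phi j z)%R by exact: expR_ge0.
pose L : R := ln #|J|%:R; pose m : R := (size s)%:R.
have J0' : (0 < #|J|%:R :> R)%R by rewrite ltr0n.
have L0 : (0 <= L)%R by rewrite ln_ge0// ler1n.
have m0 : (0 <= m)%R by exact: ler0n.
have vB0 : (0 <= v / B)%R by rewrite divr_ge0 ?(ltW B0).
pose La := (L + m * (v / B))%R.
have La0 : (0 <= La)%R by rewrite addr_ge0// mulr_ge0.
have B20 : (0 <= 2 * B)%R by rewrite mulr_ge0 ?(ltW B0).
have phile j : \int[F \x F]_z (phi j z)%:E <= (expR (v / B))%:E.
  apply: (@le_trans _ _ (\int[F \x F]_z (1 + B^-1%:E * (g j z.1 z.2)%:E))).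
    apply: ge0_le_integral => //.
    - by move=> z _; rewrite lee_fin.
    - exact/measurable_EFinP.
    - by apply: emeasurable_funD => //; apply: measurable_funeM; exact/measurable_EFinP.
    move=> z _; rewrite -EFinM -EFinD lee_fin.
    have tz := t0 j z; have tzB := tB j z.
    have h : (0 <= t j z / (2 * B) <= 1 / 2)%R.
      rewrite divr_ge0 ?mulr_ge0 ?(ltW B0)//= ler_pdivrMr ?mulr_gt0//; lra.
    apply: le_trans (expR_le_linear h) _; rewrite lerD2l.
    have -> : (2 * (t j z / (2 * B)) = B^-1 * t j z)%R by field; rewrite gt_eqF.
    by rewrite ler_wpM2l ?invr_ge0 ?(ltW B0)// /t ge_min lexx.
  rewrite ge0_integralD//; first last.
  - by apply: measurable_funeM; exact/measurable_EFinP.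
  - by move=> z _; rewrite -EFinM lee_fin mulr_ge0// invr_ge0 ltW.
  rewrite (@integral_product_cst 1)// ge0_integralZl//; first last.
  - by rewrite lee_fin invr_ge0 ltW.
  - by move=> z _; rewrite lee_fin.
  - exact/measurable_EFinP.
  apply: (@le_trans _ _ (1 + B^-1%:E * v%:E)).
    by rewrite leeD2l// lee_wpmul2l// lee_fin invr_ge0 ltW.
  rewrite -EFinM -EFinD lee_fin [(B^-1 * v)%R]mulrC; exact: expR_ge1Dx.
pose W j x := (\sum_(l <- s) t j (at_pair x l))%R.
have WE j x : expR (W j x / (2 * B)) = (\prod_(l <- s) phi j (at_pair x l))%R.
  by rewrite /W big_distrl /= expR_sum.
have mprod j : measurable_fun [set: n.-tuple E] (fun x => \prod_(l <- s) phi j (at_pair x l))%R.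
  by apply: measurable_prod => l _; exact: measurable_comp_at_pair.
have intW j : \int[mu]_x (expR (W j x / (2 * B)))%:E <= (expR (m * (v / B)))%:E.
  under eq_integral do rewrite WE.
  pose I := \int[F \x F]_z (phi j z)%:E.
  have I0 : 0 <= I by apply: integral_ge0 => z _; rewrite lee_fin.
  have Ifin : I \is a fin_num by rewrite ge0_fin_numE// (le_lt_trans (phile j))// ltry.
  have IE : I = (fine I)%:E by rewrite fineK.
  rewrite (integral_prod_at_pair muE us (mphi j) (phi0 j) IE) lee_fin.
  rewrite /m expRM_natl lerXn2r ?nnegrE ?fine_ge0 ?expR_ge0//.
  by rewrite -lee_fin -IE phile.
have h1 x : ((\big[Num.max/0%R]_j W j x) <=
    2 * B * (La + expR (- La) * \sum_j expR (W j x / (2 * B))))%R.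
  apply: bigmax_le => [|j _].
    rewrite mulr_ge0// addr_ge0// mulr_ge0 ?expR_ge0//.
    by apply: sumr_ge0 => j _; exact: expR_ge0.
  rewrite -ler_pdivrMl ?mulr_gt0// mulrC.
  apply: le_trans (le_shift_expR _ La) _; rewrite lerD2l [leLHS]expRD [leLHS]mulrC ler_wpM2l ?expR_ge0//.
  by rewrite [leRHS](bigD1 j)//= lerDl; apply: sumr_ge0 => i _; exact: expR_ge0.
have mW j : measurable_fun [set: n.-tuple E] (fun x => expR (W j x / (2 * B))).
  by rewrite (_ : (fun _ => _) = (fun x => \prod_(l <- s) phi j (at_pair x l))%R)//; exact/funext.
pose k := (2 * B * expR (- La))%R.
have k0 : (0 <= k)%R by rewrite mulr_ge0 ?expR_ge0.
have mS : measurable_fun [set: n.-tuple E] (fun x => \sum_j (expR (W j x / (2 * B)))%:E).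
  by apply: emeasurable_sum => j; exact/measurable_EFinP.
have S0 x : [set: n.-tuple E] x -> 0 <= \sum_j (expR (W j x / (2 * B)))%:E.
  by move=> _; apply: sume_ge0 => j _; rewrite lee_fin expR_ge0.
apply: (@le_trans _ _ (\int[mu]_x ((2 * B * La)%:E + k%:E * \sum_j (expR (W j x / (2 * B)))%:E))).
  apply: ge0_le_integral => //.
  - by move=> x _; rewrite lee_fin bigmax_ge_id.
  - apply/measurable_EFinP/measurable_bigmaxr => j; apply: measurable_sum => l.
    exact: (measurable_comp_at_pair l (mt j)).
  - by apply: emeasurable_funD => //; exact: measurable_funeM.
  by move=> x _; rewrite sumEFin -EFinM -EFinD lee_fin; have := h1 x; rewrite mulrDr (mulrA (2 * B)%R).
have BLa0 : (0 <= 2 * B * La)%R by rewrite mulr_ge0.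
rewrite ge0_integralD//; first last.
- exact: measurable_funeM.
- by move=> z _; rewrite mule_ge0 ?lee_fin ?S0.
have mWE j : measurable_fun [set: n.-tuple E] (fun x => (expR (W j x / (2 * B)))%:E).
  exact/measurable_EFinP.
have W0 j x : [set: n.-tuple E] x -> 0 <= (expR (W j x / (2 * B)))%:E.
  by move=> _; rewrite lee_fin expR_ge0.
rewrite integral_cst_probability ge0_integralZl// (ge0_integral_sum mu measurableT mWE W0).
apply: (@le_trans _ _ ((2 * B * La)%:E + k%:E * \sum_(j : J) (expR (m * (v / B)))%:E)).
  by rewrite leeD2l// lee_wpmul2l// lee_sum.
rewrite sumEFin -EFinM -EFinD lee_fin sumr_const -[X in (k * X)%R]mulr_natl.
have eLa : (expR (- La) * (#|J|%:R * expR (m * (v / B))) = 1)%R.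
  have -> : (#|J|%:R = expR L)%R by rewrite lnK ?posrE.
  by rewrite -!expRD addNr expR0.
have -> : (k * (#|J|%:R * expR (m * (v / B))) = 2 * B)%R by rewrite -mulrA eLa mulr1.
by rewrite le_eqVlt; apply/orP; left; apply/eqP; rewrite /La /L /m; field; rewrite gt_eqF.
Qed.

(** A term is at most its truncation at [2 * A] plus, where the maximum over [j] exceeds that level,
    this maximum itself. The second part is the same for all [j], so it needs no maximal
    inequality. *)
Lemma integral_max_matching_le s (A v : R) : uniq (endpoints s) -> (0 < A)%R -> (0 <= v)%R ->
  (forall j, \int[F \x F]_z (g j z.1 z.2)%:E <= v%:E) ->
  \int[mu]_x (\big[Num.max/0%R]_(l <- s) \big[Num.max/0%R]_j
     g j (tnth x l.1) (tnth x l.2))%:E <= A%:E ->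
  \int[mu]_x (\big[Num.max/0%R]_j \sum_(l <- s) g j (tnth x l.1) (tnth x l.2))%R%:E <=
  (4 * A * (ln #|J|%:R + 2) + n%:R * v)%:E.
Proof.
move=> us A0 v0 gv gA; pose B := (2 * A)%R.
have B0 : (0 < B)%R by rewrite mulr_gt0.
pose M (z : E * E) := \big[Num.max/0%R]_j g j z.1 z.2.
have mM : measurable_fun [set: E * E] M by exact: measurable_bigmaxr.
have M0 z : (0 <= M z)%R by exact: bigmax_ge_id.
have tail := integral_exceedance_le us mM M0 A0 gA.
have trunc := integral_max_truncated_le us B0 v0 gv.
have mhigh : measurable_fun setT (fun z => (if M z <= B then 0 else M z)%R : R).
  by apply: measurable_fun_ifT => //; exact: measurable_fun_ler.
have high0 z : (0 <= if M z <= B then 0 else M z)%R by case: ifP.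
have tailE : \int[mu]_x (\sum_(l <- s) (if M (at_pair x l) <= B then 0 else M (at_pair x l))%R%:E)
    <= (2 * A)%:E.
  apply: le_trans tail; rewrite ge0_integral_sum//; first last.
  - by move=> l x _; rewrite lee_fin.
  - by move=> l; apply/measurable_EFinP; exact: (measurable_comp_at_pair l mhigh).
  rewrite -sume_const_seq; last by apply: integral_ge0 => z _; rewrite lee_fin.
  rewrite !big_seq; apply: lee_sum => l ls.
  rewrite (@integral_at_pair1 _ _ _ _ F mu muE l (fun z => (if M z <= B then 0 else M z)%R%:E))//.
    exact: uniq_endpoints_neq ls.
  exact/measurable_EFinP.
pose t x := (\big[Num.max/0%R]_j \sum_(l <- s) Num.min (g j (tnth x l.1) (tnth x l.2)) B)%R.
pose r x := (\sum_(l <- s) (if M (at_pair x l) <= B then 0 else M (at_pair x l))%R%:E).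
have mr : measurable_fun [set: n.-tuple E] r.
  by apply: emeasurable_sum => l; apply/measurable_EFinP; exact: (measurable_comp_at_pair l mhigh).
have mt : measurable_fun [set: n.-tuple E] t.
  apply: measurable_bigmaxr => j; apply: measurable_sum => l; apply: measurable_minr => //.
  exact: (measurable_comp_at_pair l (mg j)).
apply: (@le_trans _ _ (\int[mu]_x ((t x)%:E + r x))).
  apply: ge0_le_integral => //.
  - by move=> x _; rewrite lee_fin bigmax_ge_id.
  - apply/measurable_EFinP/measurable_bigmaxr => j; apply: measurable_sum => l.
    exact: (measurable_comp_at_pair l (mg j)).
  - by apply: emeasurable_funD => //; exact/measurable_EFinP.
  move=> x _; rewrite /r sumEFin -EFinD lee_fin.
  have r0 : (0 <= \sum_(l <- s) (if M (at_pair x l) <= B then 0 else M (at_pair x l)))%R.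
    exact: sumr_ge0.
  apply: bigmax_le => [|j _]; first by rewrite addr_ge0 ?bigmax_ge_id.
  have := le_bigmax 0%R (fun j => \sum_(l <- s) Num.min (g j (tnth x l.1) (tnth x l.2)) B)%R j.
  rewrite -(@lerD2r _ (\sum_(l <- s) (if M (at_pair x l) <= B then 0 else M (at_pair x l)))%R).
  apply: le_trans; rewrite -big_split /=; apply: ler_sum => l _.
  have gM : (g j (tnth x l.1) (tnth x l.2) <= M (at_pair x l))%R.
    exact: (le_bigmax 0%R (fun j => g j (tnth x l.1) (tnth x l.2)) j).
  case: ifP => [MB|_]; first by rewrite addr0 le_min lexx (le_trans gM).
  by apply: le_trans gM _; rewrite lerDr le_min g0 ltW.
rewrite ge0_integralD//; first last.
- by move=> x _; apply: sume_ge0 => l _; rewrite lee_fin.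
- exact/measurable_EFinP.
- by move=> x _; rewrite lee_fin bigmax_ge_id.
apply: le_trans (leeD trunc tailE) _; rewrite -EFinD lee_fin /B.
have sn : (2 * (size s)%:R <= n%:R :> R)%R.
  rewrite -natrM ler_nat mul2n -addnn.
  have <- : size (endpoints s) = (size s + size s)%N.
    by rewrite /endpoints; elim: (s) => //= k s' ->; rewrite addSn addnS.
  by rewrite -(card_uniqP us) -[leqRHS]card_ord; exact: max_card.
have := ler_wpM2r v0 sn; lra.
Qed.

End matching_bound.

(** * The sum of squares over all pairs *)

Definition color n (l : 'I_n * 'I_n) : 'I_n :=
  Ordinal (ltn_pmod (l.1 + l.2) (leq_ltn_trans (leq0n l.1) (ltn_ord l.1))).

Lemma color_eq n (l k : 'I_n * 'I_n) : color l = color k -> (l.1 + l.2 = k.1 + k.2 %[mod n])%N.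
Proof. by move/(congr1 val). Qed.

Lemma modn_addl_inj n (a b c : 'I_n) : (a + b = a + c %[mod n])%N -> b = c.
Proof.
by move=> /eqP; rewrite eqn_modDl !modn_small// => /eqP /val_inj.
Qed.

(* The edges [{a, b}] of the complete graph on [Z/n] with [a + b] fixed form a matching. *)
Lemma uniq_endpoints_color n (s : seq ('I_n * 'I_n)) (c : 'I_n) : uniq s ->
  (forall l, l \in s -> (l.1 < l.2)%N /\ color l = c) -> uniq (endpoints s).
Proof.
elim: s => //= l s IH /andP[ls us] H.
have Hs k : k \in s -> (k.1 < k.2)%N /\ color k = c.
  by move=> ks; apply: H; rewrite inE ks orbT.
have [l12 lc] := H l (mem_head _ _).
(* With equal sums, one shared endpoint makes the other endpoints agree: the pairs are then equal,
   or swapped, which the order inside the pairs excludes. *)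
have diff k : k \in s -> [/\ l.1 <> k.1, l.1 <> k.2, l.2 <> k.1 & l.2 <> k.2].
  move=> ks; have [k12 kc] := Hs k ks.
  have lk : (l.1 + l.2 = k.1 + k.2 %[mod n])%N by apply: color_eq; rewrite lc kc.
  have lNk : l <> k by move=> lk'; rewrite lk' ks in ls.
  split=> e.
  - apply: lNk; rewrite [l]surjective_pairing [k]surjective_pairing.
    by move: lk; rewrite e => /modn_addl_inj ->.
  - move: lk; rewrite -e [(k.1 + _)%N]addnC => /modn_addl_inj e2.
    by move: l12; rewrite e e2 ltnNge ltnW.
  - move: lk; rewrite -e [(l.1 + _)%N]addnC => /modn_addl_inj e2.
    by move: l12; rewrite e e2 ltnNge ltnW.
  - apply: lNk; rewrite [l]surjective_pairing [k]surjective_pairing.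
    by move: lk; rewrite e ![(_ + k.2)%N]addnC => /modn_addl_inj ->.
have notin (i : 'I_n) : (forall k, k \in s -> i <> k.1 /\ i <> k.2) -> i \notin endpoints s.
  move=> Hi; apply/negP => /flatten_mapP[k ks]; rewrite !inE.
  by have [/eqP/negbTE -> /eqP/negbTE ->] := Hi k ks.
rewrite IH// andbT inE negb_or !notin ?andbT.
- by rewrite neq_ltn l12.
- by move=> k /diff[].
- by move=> k /diff[].
Qed.

Section chaos_moment.
Context d (E : measurableType d) (R : realType) (n : nat).
Variables (F : probability E R) (mu : probability (n.-tuple E) R).
Hypothesis muE : forall B : 'I_n -> set E, (forall i, measurable (B i)) ->
  mu (tuple_box B) = (\prod_(i < n) F (B i))%E.
Variables (J : finType) (f : J -> E -> E -> R).
Hypothesis mf : forall j, measurable_fun [set: E * E] (fun z => f j z.1 z.2).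
Hypothesis J0 : (0 < #|J|)%N.
Local Open Scope ereal_scope.

Definition upper (ab : 'I_n * 'I_n) : R := (ab.1 < ab.2)%:R.

(** The maximum over [j] is taken separately for each colour. This keeps the variance term at the
    order [n ^ 2] of the number of pairs and multiplies the maximum term by [n]. *)
Lemma integral_chaos_var_le (A v : R) : (0 < A)%R -> (0 <= v)%R ->
  (forall j, \int[F \x F]_z (f j z.1 z.2 ^+ 2)%:E <= v%:E) ->
  \int[mu]_x (\big[Num.max/0%R]_(l : 'I_n * 'I_n | (l.1 < l.2)%N) \big[Num.max/0%R]_j
     f j (tnth x l.1) (tnth x l.2) ^+ 2)%:E <= A%:E ->
  \int[mu]_x (chaos_var f upper x)%:E <=
  (n%:R * (4 * A * (ln #|J|%:R + 2) + n%:R * v))%:E.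
Proof.
move=> A0 v0 fv fA.
pose g j y z := (f j y z ^+ 2)%R.
have mg j : measurable_fun [set: E * E] (fun z => g j z.1 z.2) by exact: measurable_funX.
have g0 j y z : (0 <= g j y z)%R by exact: sqr_ge0.
pose s (c : 'I_n) := [seq l : 'I_n * 'I_n <- enum {: 'I_n * 'I_n} | (l.1 < l.2)%N && (color l == c)].
have us c : uniq (endpoints (s c)).
  apply: (@uniq_endpoints_color _ _ c); first by rewrite filter_uniq ?enum_uniq.
  by move=> l; rewrite mem_filter => /andP[/andP[l12 /eqP lc] _].
pose w c x := (\big[Num.max/0%R]_j \sum_(l <- s c) g j (tnth x l.1) (tnth x l.2))%R.
have mkg j (l : 'I_n * 'I_n) : measurable_fun [set: n.-tuple E] (fun x => g j (tnth x l.1) (tnth x l.2)).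
  exact: (measurable_comp_at_pair l (mg j)).
have mw c : measurable_fun [set: n.-tuple E] (w c).
  by apply: measurable_bigmaxr => j; exact: measurable_sum.
have mwE c : measurable_fun [set: n.-tuple E] (fun x => (w c x)%:E) by exact/measurable_EFinP.
have w0 c x : [set: n.-tuple E] x -> 0 <= (w c x)%:E by rewrite lee_fin bigmax_ge_id.
apply: (@le_trans _ _ (\int[mu]_x \sum_(c : 'I_n) (w c x)%:E)).
  apply: ge0_le_integral => //.
  - by move=> x _; rewrite lee_fin chaos_var_ge0.
  - by apply/measurable_EFinP; exact: measurable_chaos_var.
  - exact: emeasurable_sum.
  move=> x _; rewrite sumEFin lee_fin; apply: bigmax_le => [|j _].
    by apply: sumr_ge0 => c _; exact: bigmax_ge_id.
  have -> : (\sum_ab (upper ab * f j (tnth x ab.1) (tnth x ab.2)) ^+ 2 =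
      \sum_(c : 'I_n) \sum_(l <- s c) g j (tnth x l.1) (tnth x l.2))%R.
    transitivity (\sum_(l : 'I_n * 'I_n | (l.1 < l.2)%N) g j (tnth x l.1) (tnth x l.2))%R.
      rewrite [RHS]big_mkcond; apply: eq_bigr => l _; rewrite /upper /g.
      by case: ltnP => _; rewrite ?mul1r// mul0r expr0n.
    rewrite (partition_big (@color n) xpredT)//; apply: eq_bigr => c _.
    by rewrite big_filter big_enum_cond.
  apply: ler_sum => c _.
  exact: (le_bigmax 0%R (fun j => \sum_(l <- s c) g j (tnth x l.1) (tnth x l.2))%R j).
rewrite (ge0_integral_sum mu measurableT mwE w0).
apply: (@le_trans _ _ (\sum_(c : 'I_n) (4 * A * (ln #|J|%:R + 2) + n%:R * v)%:E)); last first.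
  by rewrite sumEFin lee_fin sumr_const card_ord [leRHS]mulr_natl.
apply: lee_sum => c _; apply: (integral_max_matching_le muE J0 mg g0 (us c) A0 v0 fv).
apply: le_trans fA; apply: ge0_le_integral => //.
- by move=> x _; rewrite lee_fin bigmax_ge_id.
- apply/measurable_EFinP; apply: measurable_bigmaxr => l.
  by apply: measurable_bigmaxr => j; exact: mkg.
- apply/measurable_EFinP; apply: measurable_bigmaxr => l.
  by apply: measurable_bigmaxr => j; exact: mkg.
move=> x _; rewrite lee_fin big_seq; apply: bigmax_le => [|l]; first exact: bigmax_ge_id.
rewrite mem_filter => /andP[/andP[l12 _] _].
exact: (le_bigmax_cond 0%R (fun l => \big[Num.max/0%R]_j g j (tnth x l.1) (tnth x l.2))).
Qed.

Hypothesis fl0 : forall j x, \int[F]_y (f j x y)%:E = 0.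
Hypothesis fr0 : forall j y, \int[F]_x (f j x y)%:E = 0.

Lemma integral_maxabs_chaos_moment_le (A D : R) : (0 < n)%N -> (0 < A)%R -> (0 < D)%R ->
  let L := ln #|J|%:R : R in (1 <= L)%R ->
  (forall j, \int[F \x F]_z (f j z.1 z.2 ^+ 2)%:E <= (D ^+ 2)%:E) ->
  \int[mu]_x (\big[Num.max/0%R]_(l : 'I_n * 'I_n | (l.1 < l.2)%N) \big[Num.max/0%R]_j
     f j (tnth x l.1) (tnth x l.2) ^+ 2)%:E <= (A ^+ 2)%:E ->
  \int[mu]_x (maxabs (chaos f upper x))%:E <=
  (3845 * (1 + 2 * expR (10 / 256)) * L * (n%:R * (D + Num.sqrt (L / n%:R) * A)))%:E.
Proof.
move=> n0 A0 D0 L L1 fD fA.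
have n0' : (0 < n%:R :> R)%R by rewrite ltr0n.
(* Up to a constant, [th] dominates the square root of the bound on the expected [chaos_var], which
   balances the two terms of the Rademacher estimate. *)
set th := (n%:R * _)%R.
have sq0 : (0 <= Num.sqrt (L / n%:R))%R by exact: sqrtr_ge0.
have th0 : (0 < th)%R.
  by rewrite mulr_gt0// ltr_pwDl// mulr_ge0 ?(ltW A0).
have var := integral_chaos_var_le (exprn_gt0 2 A0) (ltW (exprn_gt0 2 D0)) fD fA.
have c0 a : upper (a, a) = 0%R by rewrite /upper ltnn.
apply: le_trans (integral_maxabs_chaos_le muE mf J0 fl0 fr0 th0 c0) _.
have C0 : (0 <= 2 * expR (10 / 256) :> R)%R by rewrite mulr_ge0 ?expR_ge0.
set C := (2 * _)%R in C0 *; rewrite -/L in var *.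
apply: (@le_trans _ _ ((5 * (L + C))%:E * (th%:E + (64 / th)%:E *
   (n%:R * (4 * A ^+ 2 * (L + 2) + n%:R * D ^+ 2))%:E))).
  rewrite lee_wpmul2l// ?lee_fin; first by lra.
  by rewrite leeD2l// lee_wpmul2l// lee_fin divr_ge0// ltW.
rewrite [leLHS](_ : _ = (5 * (L + C) * (th + 64 / th *
   (n%:R * (4 * A ^+ 2 * (L + 2) + n%:R * D ^+ 2))))%:E)// lee_fin.
have sqE : (Num.sqrt (L / n%:R) ^+ 2 = L / n%:R)%R.
  by rewrite sqr_sqrtr// divr_ge0//; lra.
have thE : (n%:R * (4 * A ^+ 2 * (L + 2) + n%:R * D ^+ 2) <= 12 * th ^+ 2)%R.
  have -> : (th ^+ 2 = n%:R ^+ 2 * D ^+ 2 + n%:R ^+ 2 * (Num.sqrt (L / n%:R) ^+ 2) * A ^+ 2 +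
     2 * (n%:R ^+ 2 * (D * (Num.sqrt (L / n%:R) * A))))%R by rewrite /th; ring.
  have -> : (n%:R ^+ 2 * Num.sqrt (L / n%:R) ^+ 2 = n%:R * L)%R.
    by rewrite sqE; field; rewrite gt_eqF.
  have h1 : (0 <= n%:R ^+ 2 * (D * (Num.sqrt (L / n%:R) * A)))%R.
    by rewrite !mulr_ge0 ?exprn_ge0 ?(ltW A0) ?(ltW D0) ?(ltW n0').
  have h2 : (0 <= n%:R * A ^+ 2 * (L - 1))%R.
    by rewrite !mulr_ge0 ?exprn_ge0 ?(ltW A0) ?(ltW n0') ?subr_ge0.
  have h3 : (0 <= n%:R ^+ 2 * D ^+ 2)%R by rewrite mulr_ge0 ?exprn_ge0 ?(ltW D0) ?(ltW n0').
  lra.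
(* The constants: [4 * (L + 2) <= 12 * L] gives 12, then [64 * 12 = 768], and
   [5 * (1 + 768) = 3845]. *)
have h4 : (64 / th * (n%:R * (4 * A ^+ 2 * (L + 2) + n%:R * D ^+ 2)) <= 768 * th)%R.
  have -> : (768 * th = 64 / th * (12 * th ^+ 2))%R by field; rewrite gt_eqF.
  by rewrite ler_wpM2l// divr_ge0// ltW.
apply: (@le_trans _ _ (5 * (L + C) * (769 * th))%R).
  by rewrite ler_wpM2l//; lra.
have : (0 <= (L - 1) * C * th)%R.
  by apply: mulr_ge0; [apply: mulr_ge0 => //; rewrite subr_ge0|exact: ltW].
lra.
Qed.

End chaos_moment.

(** * The U-statistic *)

Lemma measurable_mktuple d (T : measurableType d) d' (E : measurableType d') n
    (X : 'I_n -> T -> E) : (forall i, measurable_fun [set: T] (X i)) ->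
  measurable_fun [set: T] (fun w => [tuple X i w | i < n]).
Proof.
move=> mX; apply/measurable_fun_tnthP => i.
rewrite [X in measurable_fun _ X](_ : _ = X i)//.
by apply/funext => w /=; rewrite tnth_mktuple.
Qed.

(** Moves expectations to the space of tuples, where a single coordinate can be resampled. *)
Lemma tuple_law_exists d (T : measurableType d) (R : realType) (P : probability T R)
    d' (E : measurableType d') (F : probability E R) n (X : 'I_n -> T -> E) :
  (forall i, measurable_fun [set: T] (X i)) ->
  (forall B : 'I_n -> set E, (forall i, measurable (B i)) ->
     P [set w | forall i, B i (X i w)] = (\prod_(i < n) F (B i))%E) ->
  exists2 mu : probability (n.-tuple E) R,
    (forall B : 'I_n -> set E, (forall i, measurable (B i)) ->
       mu (tuple_box B) = (\prod_(i < n) F (B i))%E) &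
    (forall phi : n.-tuple E -> R, measurable_fun [set: n.-tuple E] phi ->
       (forall x, 0 <= phi x) ->
       (\int[P]_w (phi [tuple X i w | i < n])%:E = \int[mu]_x (phi x)%:E)%E).
Proof.
move=> mX PX; pose xt w : n.-tuple E := [tuple X i w | i < n].
have mxt : measurable_fun [set: T] xt by exact: measurable_mktuple.
pose mixin := isMeasurableFun.Build _ _ _ _ xt mxt.
pose Y : {mfun T >-> n.-tuple E} := HB.pack xt mixin.
exists (distribution P Y) => [B mB|phi mphi phi0].
  rewrite -PX//; congr (P _); apply/seteqP; split => w /= H i.
    by have := H i; rewrite tnth_mktuple.
  by rewrite tnth_mktuple.
rewrite ge0_integral_distribution//; exact/measurable_EFinP.
Qed.

Lemma integral_exp_le_Lnorm d (T : measurableType d) (R : realType)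
    (Q : {measure set T -> \bar R}) (h : T -> R) (c : R) (k : nat) : (0 < k)%N ->
  (Lnorm Q k%:R%:E (fun z => (h z)%:E) <= c%:E)%E ->
  (\int[Q]_z (`|h z| ^+ k)%:E <= (c ^+ k)%:E)%E.
Proof.
move=> k0; have k0' : k%:R != 0 :> R by rewrite pnatr_eq0 -lt0n.
have := poweR_Lnorm Q (fun z => (h z)%:E) k0'.
have := Lnorm_ge0 Q k%:R%:E (fun z => (h z)%:E).
case: (Lnorm _ _ _) => [t|//|//]; rewrite !lee_fin => t0 tE tc.
have -> : (\int[Q]_z (`|h z| ^+ k)%:E = (t ^+ k)%:E)%E.
  rewrite -(powR_mulrn k t0) -poweR_EFin tE; apply: eq_integral => z _.
  by rewrite abse_EFin poweR_EFin powR_mulrn.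
by rewrite lee_fin lerXn2r ?nnegrE ?(le_trans t0).
Qed.

(** The moments [a] and [b] may be infinite or zero, whereas choosing [th] requires positive reals.
    An infinite moment makes the right side infinite; finite ones are approached from above by
    [a + dl] and [b + dl], with [dl] chosen so that the total excess is [e]. *)
Lemma le_scaled_sum3 (R : realType) (x a b c : \bar R) (k m s t u : R) :
  0 < k -> 1 <= m -> 0 < s -> 0 < t -> 0 <= u -> (0 <= a)%E -> (0 <= b)%E -> (0 <= c)%E ->
  (forall A D : R, 0 < A -> 0 < D -> (a <= A%:E)%E -> (b <= D%:E)%E ->
     (x <= (k * (t * D + s * A))%:E)%E) ->
  (x <= (k * m)%:E * (s%:E * a + t%:E * b + u%:E * c))%E.
Proof.
move=> k0 m1 s0 t0 u0 a0 b0 c0 H.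
have sa0 : (0 <= s%:E * a)%E by rewrite mule_ge0// lee_fin ltW.
have tb0 : (0 <= t%:E * b)%E by rewrite mule_ge0// lee_fin ltW.
apply: (@le_trans _ _ (k%:E * (s%:E * a + t%:E * b))%E); last first.
  apply: (@le_trans _ _ ((k * m)%:E * (s%:E * a + t%:E * b))%E).
    rewrite lee_wpmul2r ?adde_ge0// lee_fin -[leLHS]mulr1 ler_wpM2l// ltW//.
  rewrite lee_wpmul2l ?lee_fin ?mulr_ge0 ?(ltW k0) ?(le_trans ler01)//.
  by rewrite leeDl// mule_ge0.
case: a a0 sa0 H => [a| |//] a0 sa0 H; last first.
  by rewrite gt0_muley ?lte_fin// addye ?gt0_muley ?leey// -ltNye (lt_le_trans _ tb0).
case: b b0 tb0 H => [b| |//] b0 tb0 H; last first.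
  by rewrite (gt0_muley (x := t%:E)) ?lte_fin// addey ?gt0_muley ?leey// -ltNye (lt_le_trans _ sa0).
apply/lee_addgt0Pr => e e0; rewrite !lee_fin in a0 b0.
pose dl := e / (k * (t + s)).
have kts : 0 < k * (t + s) by rewrite mulr_gt0// addr_gt0.
have dl0 : 0 < dl by rewrite divr_gt0.
apply: le_trans (H (a + dl) (b + dl) _ _ _ _) _; rewrite ?lee_fin ?lerDl ?(ltW dl0) ?ltr_wpDl//.
have : k * (t + s) * dl = e by rewrite /dl mulrC divfK// gt_eqF.
lra.
Qed.

Section Ustat.
Context (R : realType) (n p : nat) (d : measure_display) (T : measurableType d).
Variables (P : probability T R) (F : probability (p.-tuple R) R).
Variables (X X' : 'I_n -> T -> p.-tuple R) (f : p.-tuple R -> p.-tuple R -> 'M[R]_p).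
Hypothesis n2 : (2 <= n)%N.
Hypothesis p2 : (2 <= p)%N.
Hypothesis mX : forall i, measurable_fun [set: T] (X i).
Hypothesis mX' : forall i, measurable_fun [set: T] (X' i).
Hypothesis indep : pl_mutually_independent P
  (fun s : 'I_n + 'I_n => match s with inl i => X i | inr i => X' i end).
Hypothesis XF : forall i, pl_has_distribution P (X i) F.
Hypothesis mf : pl_measurable_kernel f.
Hypothesis cf : pl_canonical_kernel F f.

Lemma independent_box (B : 'I_n -> set (p.-tuple R)) : (forall i, measurable (B i)) ->
  P [set w | forall i, B i (X i w)] = (\prod_(i < n) F (B i))%E.
Proof.
move=> mB; pose A (s : 'I_n + 'I_n) := match s with inl i => B i | inr _ => setT end.
have mA s : measurable (A s) by case: s => i /=.
have := indep mA; rewrite big_sumType /=.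
rewrite [X in (_ * X)%E]big1 ?mule1; last first.
  by move=> i _; rewrite preimage_setT; exact: probability_setT.
under [X in _ = X -> _]eq_bigr do rewrite XF//.
move=> <-; congr (P _); apply/seteqP; split => w /= H.
  by case=> i _ //=; exact: H.
by move=> i; exact: (H (inl i) I).
Qed.

(** The matrix kernel becomes a family of [p ^ 2] scalar kernels; the logarithm of its size is
    [2 * ln p%:R]. *)
Let J := ('I_p * 'I_p)%type.
Let fJ (j : J) y z : R := f y z j.1 j.2.
Let xt w := [tuple X i w | i < n].

Lemma pl_maxnorm_Ustat_le w :
  pl_maxnorm (pl_Ustat f X w) <= 'C(n, 2)%:R^-1 * maxabs (chaos fJ (@upper R n) (xt w)).
Proof.
have b0 : 0 <= 'C(n, 2)%:R^-1 :> R by rewrite invr_ge0.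
apply: bigmax_le => [|m _]; first by rewrite mulr_ge0 ?maxabs_ge0.
apply: bigmax_le => [|k _]; first by rewrite mulr_ge0 ?maxabs_ge0.
rewrite /pl_Ustat mxE normrM ger0_norm// ler_wpM2l//.
have := le_maxabs (chaos fJ (@upper R n) (xt w)) (m, k).
congr (`| _ | <= _); rewrite /chaos summxE.
under [RHS]eq_bigr => i _ do rewrite summxE big_mkcond /=.
rewrite pair_bigA /=; apply: eq_bigr => -[a b] _ /=.
by rewrite /fJ !tnth_mktuple /upper /=; case: ltnP => _; rewrite ?mul1r ?mul0r.
Qed.

Lemma max_kernel_sqr_le w :
  \big[Num.max/0]_(l : 'I_n * 'I_n | (l.1 < l.2)%N) \big[Num.max/0]_j
    fJ j (tnth (xt w) l.1) (tnth (xt w) l.2) ^+ 2 <= pl_Mmax f X X' w ^+ 2.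
Proof.
have M0 : 0 <= pl_Mmax f X X' w by exact: bigmax_ge_id.
apply: bigmax_le => [|[a b] /= ab]; first exact: exprn_ge0.
apply: bigmax_le => [|[m k] _]; first exact: exprn_ge0.
rewrite -real_normK ?num_real// lerXn2r ?nnegrE// /fJ !tnth_mktuple /=.
pose G i j := Num.max (pl_maxnorm (f (X i w) (X j w))) (pl_maxnorm (f (X i w) (X' j w))).
have h1 := le_bigmax 0 (fun i : 'I_n => \big[Num.max/0]_(j < n | (i < j)%N) G i j) a.
have h2 := le_bigmax_cond (j := b) (P := fun j : 'I_n => (a < j)%N) 0 (fun j => G a j) ab.
apply: le_trans (le_trans h2 h1); rewrite le_max; apply/orP; left.
have h3 := le_bigmax 0 (fun m : 'I_p => \big[Num.max/0]_k `|f (X a w) (X b w) m k|) m.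
apply: le_trans h3; exact: (le_bigmax 0 (fun k => `|f (X a w) (X b w) m k|) k).
Qed.

Lemma measurable_pl_maxnorm (U V : T -> p.-tuple R) :
  measurable_fun [set: T] U -> measurable_fun [set: T] V ->
  measurable_fun [set: T] (fun w => pl_maxnorm (f (U w) (V w))).
Proof.
move=> mU mV; rewrite /pl_maxnorm; apply: measurable_bigmaxr => m; apply: measurable_bigmaxr => k.
apply: (measurableT_comp (@normr_measurable R setT)).
exact: (measurableT_comp (mf m k) (measurable_fun_pair mU mV)).
Qed.

Lemma measurable_pl_Mmax : measurable_fun [set: T] (pl_Mmax f X X').
Proof.
apply: measurable_bigmaxr => i; apply: measurable_bigmaxr => j.
by apply: measurable_maxr; exact: measurable_pl_maxnorm.
Qed.

Lemma measurable_pl_maxnorm_Ustat : measurable_fun [set: T] (fun w => pl_maxnorm (pl_Ustat f X w)).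
Proof.
apply: measurable_bigmaxr => m; apply: measurable_bigmaxr => k.
apply: (measurableT_comp (@normr_measurable R setT)).
rewrite [X in measurable_fun _ X](_ : _ = (fun w => 'C(n, 2)%:R^-1 *
   \sum_(i < n) \sum_(j < n) if (i < j)%N then f (X i w) (X j w) m k else 0)); last first.
  apply/funext => w; rewrite /pl_Ustat mxE summxE; congr (_ * _).
  by apply: eq_bigr => i _; rewrite summxE [LHS]big_mkcond.
apply: measurable_funM => //; apply: measurable_sum => i; apply: measurable_sum => j.
case: ltnP => _; last exact: measurable_cst.
exact: (measurableT_comp (mf m k) (measurable_fun_pair (mX i) (mX j))).
Qed.

Lemma integral_pl_maxnorm_Ustat_le (A D : R) : 0 < A -> 0 < D ->
  (Lnorm P 4%:E (fun w => (pl_Mmax f X X' w)%:E) <= A%:E)%E -> (pl_Dq F f 2 <= D%:E)%E ->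
  let lp := ln p%:R / n%:R in
  (\int[P]_w (pl_maxnorm (pl_Ustat f X w))%:E <=
   (16 * (3845 * (1 + 2 * expR (10 / 256))) * (lp * D + lp `^ (3 / 2) * A))%:E)%E.
Proof.
move=> A0 D0 MA DD /=; set lp := ln p%:R / n%:R.
have [mu muE intE] := tuple_law_exists mX independent_box.
have mfJ j : measurable_fun [set: p.-tuple R * p.-tuple R] (fun z => fJ j z.1 z.2).
  exact: mf.
have fl0 j x : (\int[F]_y (fJ j x y)%:E = 0)%E by have [H _] := cf j.1 j.2; exact: H.
have fr0 j y : (\int[F]_x (fJ j x y)%:E = 0)%E by have [_ [H _]] := cf j.1 j.2; exact: H.
have n0 : (0 < n)%N by exact: ltn_trans n2.
have n0' : 0 < n%:R :> R by rewrite ltr0n.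
have p0' : 0 < p%:R :> R by rewrite ltr0n (ltn_trans _ p2).
(* Since [expR (1 / 2) <= 2 <= p]; doubled, this is the condition [1 <= L] on the logarithm of
   [p ^ 2]. *)
have lnp : 1 / 2 <= ln p%:R :> R.
  rewrite -[leLHS]expRK ler_ln ?posrE ?expR_gt0//.
  apply: (@le_trans _ _ 2); last by rewrite ler_nat.
  have := @expR_le_linear R (1 / 2); lra.
have cardJ : #|{: J}| = (p ^ 2)%N by rewrite card_prod !card_ord mulnn.
have J0 : (0 < #|{: J}|)%N by rewrite cardJ expn_gt0 (ltn_trans _ p2).
have LE : ln #|{: J}|%:R = 2 * ln p%:R :> R.
  by rewrite cardJ natrX lnXn// mulr_natl.
have L1 : 1 <= ln #|{: J}|%:R :> R by rewrite LE; lra.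
have fD j : (\int[F \x F]_z (fJ j z.1 z.2 ^+ 2)%:E <= (D ^+ 2)%:E)%E.
  have := @integral_exp_le_Lnorm _ _ R (F \x F)%E (fun z => fJ j z.1 z.2) D 2 isT.
  under eq_integral do rewrite real_normK ?num_real//.
  apply; apply: le_trans DD.
  pose N m k := Lnorm (F \x F)%E 2%:E (fun z => (f z.1 z.2 m k)%:E).
  have h1 := le_bigmax 0%E (fun m => \big[maxe/0%E]_k N m k) j.1.
  apply: le_trans h1; exact: (le_bigmax 0%E (fun k => N j.1 k) j.2).
pose S (x : n.-tuple (p.-tuple R)) := \big[Num.max/0]_(l : 'I_n * 'I_n | (l.1 < l.2)%N)
   \big[Num.max/0]_j fJ j (tnth x l.1) (tnth x l.2) ^+ 2.
have mS : measurable_fun [set: n.-tuple (p.-tuple R)] S.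
  apply: measurable_bigmaxr => l; apply: measurable_bigmaxr => j; apply: measurable_funX.
  exact: measurable_kernel_tnth.
have S0 x : 0 <= S x by exact: bigmax_ge_id.
have mM := measurable_pl_Mmax.
have M0 w : 0 <= pl_Mmax f X X' w by exact: bigmax_ge_id.
have fA : (\int[mu]_x (S x)%:E <= (A ^+ 2)%:E)%E.
  rewrite -intE//.
  have M4 := @integral_exp_le_Lnorm _ _ R P (pl_Mmax f X X') A 4 isT MA.
  (* The second moment is controlled by the fourth through [M ^+ 2 <= A ^+ 2 / 2 + M ^+ 4 / (2 * A
     ^+ 2)], whose right side has expectation at most [A ^+ 2]. *)
  pose c := (2 * A ^+ 2)^-1.
  have c0 : 0 <= c by rewrite invr_ge0 mulr_ge0 ?exprn_ge0 ?ltW.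
  apply: (@le_trans _ _ (\int[P]_w ((A ^+ 2 / 2)%:E + c%:E * (`|pl_Mmax f X X' w| ^+ 4)%:E))%E).
    have mxt : measurable_fun [set: T] xt by exact: measurable_mktuple.
    apply: ge0_le_integral => //.
    - by move=> w _; rewrite lee_fin.
    - by apply/measurable_EFinP; exact: (measurableT_comp mS mxt).
    - apply: emeasurable_funD => //; apply: measurable_funeM; apply/measurable_EFinP.
      by apply: measurable_funX; apply: measurableT_comp => //; exact: normr_measurable.
    move=> w _; rewrite -EFinM -EFinD lee_fin; apply: le_trans (max_kernel_sqr_le w) _.
    rewrite ger0_norm//; set M := pl_Mmax f X X' w.
    have A2 : 0 < A ^+ 2 by rewrite exprn_gt0.
    have cE : c * (2 * A ^+ 2) = 1 by rewrite /c mulVf// gt_eqF// mulr_gt0.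
    have square (a u z : R) : a ^+ 2 / 2 + z * u ^+ 4 = u ^+ 2 + z * (u ^+ 2 - a ^+ 2) ^+ 2 +
        (1 - z * (2 * a ^+ 2)) * (a ^+ 2 / 2 - u ^+ 2) by field.
    by rewrite square cE subrr mul0r addr0 lerDl mulr_ge0// sqr_ge0.
  have mM4 : measurable_fun [set: T] (fun w => (`|pl_Mmax f X X' w| ^+ 4)%:E).
    apply/measurable_EFinP.
    by apply: measurable_funX; apply: measurableT_comp => //; exact: normr_measurable.
  have M40 w : [set: T] w -> (0 <= (`|pl_Mmax f X X' w| ^+ 4)%:E)%E.
    by move=> _; rewrite lee_fin exprn_ge0.
  rewrite ge0_integralD//; first last.
  - exact: measurable_funeM.
  - by move=> w wT; rewrite mule_ge0// ?lee_fin//; exact: M40.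
  - by move=> w _; rewrite lee_fin divr_ge0 ?exprn_ge0 ?ltW.
  rewrite ge0_integralZl// integral_cst_probability.
  apply: (@le_trans _ _ ((A ^+ 2 / 2)%:E + c%:E * (A ^+ 4)%:E)%E).
    by rewrite leeD2l// lee_wpmul2l.
  rewrite -EFinM -EFinD lee_fin le_eqVlt; apply/orP; left; apply/eqP.
  by rewrite /c; field; rewrite gt_eqF.
have key := integral_maxabs_chaos_moment_le muE mfJ J0 fl0 fr0 n0 A0 D0 L1 fD fA.
pose b2 : R := 'C(n, 2)%:R^-1.
have b20 : 0 <= b2 by rewrite invr_ge0.
have mN : measurable_fun [set: n.-tuple (p.-tuple R)]
    (fun x => maxabs (chaos fJ (@upper R n) x)).
  apply: (@measurable_maxabs _ _ _ _ _ (fun j x => chaos fJ (@upper R n) x j)) => j.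
  exact: measurable_chaos.
apply: (@le_trans _ _ (\int[P]_w (b2 * maxabs (chaos fJ (@upper R n) (xt w)))%:E)%E).
  have mxt : measurable_fun [set: T] xt by exact: measurable_mktuple.
  apply: ge0_le_integral => //.
  - by move=> w _; rewrite lee_fin; exact: bigmax_ge_id.
  - by apply/measurable_EFinP; exact: measurable_pl_maxnorm_Ustat.
  - apply/measurable_EFinP; apply: measurable_funM => //.
    exact: (measurableT_comp mN mxt).
  by move=> w _; rewrite lee_fin; exact: pl_maxnorm_Ustat_le.
rewrite (intE (fun x => b2 * maxabs (chaos fJ (@upper R n) x))); first last.
- by move=> x; rewrite mulr_ge0 ?maxabs_ge0.
- exact: measurable_funM.
under eq_integral do rewrite EFinM.
rewrite ge0_integralZl//; first last.
- by move=> x _; rewrite lee_fin maxabs_ge0.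
- exact/measurable_EFinP.
apply: le_trans (lee_wpmul2l _ key) _; first by rewrite lee_fin.
rewrite -EFinM lee_fin.
have lp0 : 0 <= lp by rewrite divr_ge0 ?(ltW n0')//; lra.
have -> : lp `^ (3 / 2) = lp * Num.sqrt lp.
  have -> : 3 / 2 = 1 + 2^-1 :> R by field.
  by rewrite powRD ?powRr1 ?powR12_sqrt//; apply/implyP => /eqP; lra.
rewrite LE; have -> : 2 * ln p%:R / n%:R = 2 * lp by rewrite /lp mulrA.
have -> : ln p%:R = n%:R * lp :> R by rewrite /lp mulrCA divff ?mulr1// gt_eqF.
have sq2 : Num.sqrt (2 * lp) <= 2 * Num.sqrt lp.
  rewrite sqrtrM// ler_wpM2r ?sqrtr_ge0// -[leRHS]ger0_norm// -sqrtr_sqr ler_sqrt; lra.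
have b2le : b2 * n%:R ^+ 2 <= 4.
  have n2' : 2 <= n%:R :> R by rewrite ler_nat.
  have bE : 2 * 'C(n, 2)%:R = n%:R * (n%:R - 1) :> R.
    by rewrite -natrM -mul_bin_diag bin1 natrM -subn1 natrB.
  have C0 : 0 < 'C(n, 2)%:R :> R by rewrite ltr0n bin_gt0.
  rewrite /b2 ler_pdivrMl//; nra.
pose K1 : R := 3845 * (1 + 2 * expR (10 / 256)).
have K10 : 0 <= K1.
  apply: mulr_ge0; first exact: ler0n.
  by apply: addr_ge0; [exact: ler01|apply: mulr_ge0; [exact: ler0n|exact: expR_ge0]].
rewrite -/K1; move: K1 K10 => K1 K10; set q := Num.sqrt (2 * lp) in sq2 *; set r := Num.sqrt lp in sq2 *.
pose Z := lp * D + lp * q * A.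
have Zle : Z <= 2 * (lp * D + lp * r * A).
  have h1 : 0 <= lp * (2 * r - q) * A.
    by apply: mulr_ge0; [apply: mulr_ge0 => //; rewrite subr_ge0|exact: ltW].
  have h2 : 0 <= lp * D by rewrite mulr_ge0// ltW.
  rewrite /Z; lra.
have Z0 : 0 <= Z.
  apply: addr_ge0; first by apply: mulr_ge0 => //; exact: ltW.
  by apply: mulr_ge0; [apply: mulr_ge0 => //; exact: sqrtr_ge0|exact: ltW].
(* The factor 16 is 4 * 2 * 2: [b2 * n%:R ^+ 2 <= 4] because [n >= 2], the logarithm of [p ^ 2]
   gives 2, and the last 2 comes from [Num.sqrt (2 * lp) <= 2 * Num.sqrt lp]. *)
have -> : b2 * (K1 * (2 * (n%:R * lp)) * (n%:R * (D + q * A))) =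
    (b2 * n%:R ^+ 2) * (2 * K1 * Z) by rewrite /Z; ring.
have KZ0 : 0 <= 2 * K1 * Z.
  by apply: mulr_ge0 => //; apply: mulr_ge0.
apply: le_trans (ler_wpM2r KZ0 b2le) _.
have := ler_wpM2l K10 Zle; lra.
Qed.

End Ustat.

Unset Implicit Arguments.
Set Strict Implicit.

Theorem theorem5p1 (R : realType) :
  exists K : R, 0 < K /\
  forall (b : R), 0 < b ->
  forall (n p : nat), (2 <= n)%N -> (2 <= p)%N ->
    p%:R <= expR (b * n%:R) ->
  forall (d : measure_display) (T : measurableType d) (P : probability T R)
    (F : probability (p.-tuple R) R)
    (X X' : 'I_n -> T -> p.-tuple R)
    (f : p.-tuple R -> p.-tuple R -> 'M[R]_p),
    (forall i, measurable_fun [set: T] (X i)) ->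
    (forall i, measurable_fun [set: T] (X' i)) ->
    pl_mutually_independent P
      (fun s : 'I_n + 'I_n => match s with inl i => X i | inr i => X' i end) ->
    (forall i, pl_has_distribution P (X i) F) ->
    (forall i, pl_has_distribution P (X' i) F) ->
    pl_symmetric_kernel f ->
    pl_measurable_kernel f ->
    pl_canonical_kernel F f ->
    (\int[(F \x F)%E]_z (pl_maxnorm (f z.1 z.2))%:E < +oo)%E ->
    let lp := ln p%:R / n%:R in
    (\int[P]_w (pl_maxnorm (pl_Ustat f X w))%:E <=
      (K * Num.max 1 (Num.sqrt b))%:E *
        ((lp `^ (3 / 2))%:E * Lnorm P 4%:E (fun w => (pl_Mmax f X X' w)%:E)
         + lp%:E * pl_Dq F f 2
         + (lp `^ (5 / 4))%:E * pl_Dq F f 4))%E.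
Proof.
pose K : R := 16 * (3845 * (1 + 2 * expR (10 / 256))).
have K0 : 0 < K.
  apply: mulr_gt0; first by rewrite ltr0n.
  apply: mulr_gt0; first by rewrite ltr0n.
  by apply: ltr_pwDl; [exact: ltr01|apply: mulr_ge0; [exact: ler0n|exact: expR_ge0]].
exists K; split=> // b b0 n p n2 p2 _ d T P F X X' f mX mX' indep XF _ _ mf cf _ /=.
set lp := ln p%:R / n%:R.
have lp0 : 0 < lp.
  by rewrite divr_gt0 ?ln_gt0 ?ltr1n ?ltr0n// (ltn_trans _ n2).
apply: le_scaled_sum3 => //.
- by rewrite le_max lexx.
- exact: powR_gt0.
- exact: powR_ge0.
- exact: Lnorm_ge0.
- exact: bigmax_ge_id.
- exact: bigmax_ge_id.
- move=> A D A0 D0 MA DD.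
  exact: (integral_pl_maxnorm_Ustat_le n2 p2 mX mX' indep XF mf cf A0 D0 MA DD).
Qed.
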